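(* Let $\Gamma$ be a non-empty finite connected graph, $\mathcal{L}(\Gamma)$ a labeled graph over $\Gamma$, $G$ the GBS-group defined by $\mathcal{L}(\Gamma)$, and $\Delta\colon G\to\mathbb{Q}^*$ its modular homomorphism. Let $\mathcal{C}$ be a root class of groups consisting only of periodic groups and let $\rho(\mathcal{C})$ be the set of primes $p$ such that $p$ divides the order of some element of some group in $\mathcal{C}$. Suppose that $G$ is not solvable and that $\mathcal{L}(\Gamma)$ is reduced. 1. If $\operatorname{Im}\Delta=\{1\}$, then $G$ is residually a $\mathcal{C}$-group if and only if all the labels of $\mathcal{L}(\Gamma)$ are $\rho(\mathcal{C})$-numbers. 2. If $\operatorname{Im}\Delta=\{1,-1\}$, then $G$ is residually a $\mathcal{C}$-group if and only if all the labels of $\mathcal{L}(\Gamma)$ are $\rho(\mathcal{C})$-numbers and $2\in\rho(\mathcal{C})$. 3. If $\operatorname{Im}\Delta\not\subseteq\{1,-1\}$, then $G$ is not residually a $\mathcal{C}$-group.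
   Context: Classes of groups are understood to be closed under isomorphism. A class $\mathcal{C}$ of groups is root if it contains at least one non-unit group and is closed under taking subgroups, extensions (an extension of a $\mathcal{C}$-group by a $\mathcal{C}$-group is a $\mathcal{C}$-group), and Cartesian (unrestricted direct) products of the form $\prod_{y\in Y}X_y$, where $X,Y\in\mathcal{C}$ and $X_y$ is an isomorphic copy of $X$ for every $y\in Y$. A group $G$ is residually a $\mathcal{C}$-group if for every non-unit $g\in G$ there is a homomorphism $\sigma$ of $G$ onto a group of $\mathcal{C}$ with $g\sigma\neq 1$. For a set $\rho$ of primes, a $\rho$-number is an integer all of whose prime divisors belong to $\rho$. $\mathrm{BS}(m,n)=\langle a,b;\ a^{-1}b^ma=b^n\rangle$ for non-zero integers $m,n$. Labeled graphs and GBS-groups. $\Gamma=(V,E)$ is a non-empty finite connected undirected graph (loops and multiple edges allowed). The ends of an edge $e$ are denoted $e(1),e(-1)$ (in a fixed order; they coincide if $e$ is a loop). A labeled graph $\mathcal{L}(\Gamma)$ is obtained by assigning to each $e\in E$ non-zero integers $\lambda(+e)$ (at $e(1)$) and $\lambda(-e)$ (at $e(-1)$), called labels; we write $\lambda(\varepsilon e)$, $\varepsilon=\pm1$. Fix a maximal subtree $T$ of $\Gamma$ with edge set $E_T$. The GBS-group defined by $\mathcal{L}(\Gamma)$ (the fundamental group of the corresponding graph of infinite cyclic groups) is the group $G=\pi_1(\mathcal{L}(\Gamma))$ with generators $g_v$ ($v\in V$), $t_e$ ($e\in E\setminus E_T$) and defining relations $g_{e(1)}^{\lambda(+e)}=g_{e(-1)}^{\lambda(-e)}$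 ($e\in E_T$), $t_e^{-1}g_{e(1)}^{\lambda(+e)}t_e=g_{e(-1)}^{\lambda(-e)}$ ($e\in E\setminus E_T$); up to isomorphism it does not depend on $T$. The vertex groups are the subgroups $G_v=\langle g_v\rangle$, which are infinite cyclic. $\mathcal{L}(\Gamma)$ is reduced if for all $e\in E$, $\varepsilon=\pm1$, $|\lambda(\varepsilon e)|=1$ implies that $e$ is a loop. $G$ is elementary if it is isomorphic to $\mathbb{Z}$, $\mathrm{BS}(1,1)$ or $\mathrm{BS}(1,-1)$ (elementary groups are solvable). An element of $G$ is elliptic if it is conjugate to an element of some vertex group. Modular homomorphism. If $G$ is not elementary, $\Delta\colon G\to\mathbb{Q}^*$ is defined as follows: for $g\in G$ take any non-unit elliptic element $a$ and non-zero integers $m,n$ with $g^{-1}a^mg=a^n$ (they exist), and put $\Delta(g)=n/m$; this is a well-defined homomorphism independent of the choices. *)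

(* Defs.v *)
From HB Require Import structures.
From mathcomp Require Import all_boot all_order all_algebra.
From mathcomp Require Import boolp classical_sets.

Set Implicit Arguments.
Unset Strict Implicit.
Unset Printing Implicit Defensive.

Local Open Scope classical_set_scope.
Local Open Scope group_scope.

Section Groups.
Context (G : groupType).
Implicit Types (x : G) (A : set G).

Definition expgz x (k : int) : G :=
  match k with Posz n => x ^+ n | Negz n => x ^- n.+1 end.

Definition element_order x (n : nat) : Prop :=
  [/\ (0 < n)%N, x ^+ n = 1 & forall k, (0 < k < n)%N -> x ^+ k <> 1].

Definition periodic : Prop := forall x, exists2 n, (0 < n)%N & x ^+ n = 1.

Definition is_subgroup A : Prop :=
  A 1 /\ (forall x y, A x -> A y -> A (x / y)).

Definition generated A : set G := smallest is_subgroup A.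

Fixpoint derived (n : nat) : set G :=
  if n is m.+1 then
    generated [set [~ x, y] | x in derived m & y in derived m]
  else setT.

Definition is_solvable : Prop := exists n, derived n `<=` [set 1].

End Groups.

Definition isomorphic (G H : groupType) : Prop :=
  exists f : {multiplicative G -> H}, bijective f.

Definition cartesian_product (Y : Type) (F : Y -> groupType) : Type :=
  forall y, F y.

Section CartesianProduct.
Context (Y : Type) (F : Y -> groupType).
Implicit Types f g : cartesian_product F.

Definition cp_one : cartesian_product F := fun=> 1.
Definition cp_inv f : cartesian_product F := fun y => (f y)^-1.
Definition cp_mul f g : cartesian_product F := fun y => f y * g y.

Fact cp_mulA : associative cp_mul.
Proof. by move=> f g h; apply: functional_extensionality_dep => y; apply: mulgA. Qed.
Fact cp_mul1 : left_id cp_one cp_mul.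
Proof. by move=> f; apply: functional_extensionality_dep => y; apply: mul1g. Qed.
Fact cp_mulr1 : right_id cp_one cp_mul.
Proof. by move=> f; apply: functional_extensionality_dep => y; apply: mulg1. Qed.
Fact cp_mulV : left_inverse cp_one cp_inv cp_mul.
Proof. by move=> f; apply: functional_extensionality_dep => y; apply: mulVg. Qed.
Fact cp_mulrV : right_inverse cp_one cp_inv cp_mul.
Proof. by move=> f; apply: functional_extensionality_dep => y; apply: mulgV. Qed.

HB.instance Definition _ := Choice.copy (cartesian_product F) (forall y, F y).
HB.instance Definition _ := isGroup.Build (cartesian_product F)
  cp_mulA cp_mul1 cp_mulr1 cp_mulV cp_mulrV.

End CartesianProduct.

(* [C G] says that the group [G] belongs to the class [C]. *)
Definition group_class := groupType -> Prop.

Section Classes.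
Context (C : group_class).

Definition iso_closed : Prop :=
  forall G H : groupType, isomorphic G H -> C G -> C H.

Definition subgroup_closed : Prop :=
  forall (G : groupType) (S : pred G) (H : subGroupType S), C G -> C H.

(* [G] is an extension of [N] by [Q]: 1 -> N -> G -> Q -> 1 is exact. *)
Definition extension_closed : Prop :=
  forall (N G Q : groupType)
         (i : {multiplicative N -> G}) (q : {multiplicative G -> Q}),
    injective i -> range q = setT -> range i = q @^-1` [set 1] ->
    C N -> C Q -> C G.

(* The product is indexed by the elements of a group [Y] of the class. *)
Definition product_closed : Prop :=
  forall (X Y : groupType) (F : Y -> groupType),
    C X -> C Y -> (forall y, isomorphic X (F y)) ->
    C (cartesian_product F).

Definition root_class : Prop :=
  [/\ iso_closed, (exists2 G : groupType, C G & exists x : G, x <> 1),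
      subgroup_closed, extension_closed & product_closed].

Definition class_primes : set nat :=
  [set p | prime p /\ exists (G : groupType) (x : G) (n : nat),
             [/\ C G, element_order x n & (p %| n)%N]].

Definition residually (G : groupType) : Prop :=
  forall g : G, g <> 1 ->
    exists (H : groupType) (s : {multiplicative G -> H}),
      [/\ C H, range s = setT & s g <> 1].

End Classes.

Definition rho_number (rho : set nat) (k : int) : Prop :=
  forall p, prime p -> (p %| `|k|)%N -> rho p.

(* The letter [(x, true)] stands for the generator [x], and [(x, false)] for
   its inverse. *)
Definition word (X : Type) : Type := seq (X * bool).

Definition word_inv (X : Type) (w : word X) : word X :=
  rev [seq (l.1, ~~ l.2) | l <- w].

Definition word_pow (X : Type) (x : X) (k : int) : word X :=
  match k with
  | Posz n => nseq n (x, true)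
  | Negz n => nseq n.+1 (x, false)
  end.

Section Presentation.
Context (X : choiceType) (R : word X -> word X -> Prop).
Implicit Types u v w : word X.

(* The least congruence on words containing free reduction and the defining
   relations [u = v] for [R u v]. *)
Inductive word_eq : word X -> word X -> Prop :=
| word_eq_refl u : word_eq u u
| word_eq_sym u v : word_eq u v -> word_eq v u
| word_eq_trans u v w : word_eq u v -> word_eq v w -> word_eq u w
| word_eq_cat u u' v v' :
    word_eq u u' -> word_eq v v' -> word_eq (u ++ v) (u' ++ v')
| word_eq_cancel x b : word_eq [:: (x, b); (x, ~~ b)] [::]
| word_eq_rel u v : R u v -> word_eq u v.

Definition word_eqb u v : bool := `[< word_eq u v >].

Fact word_eqb_equiv : equiv_class_of word_eqb.
Proof.
split=> [u|u v|v u w].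
- by apply/asboolP; apply: word_eq_refl.
- by apply/asboolP/asboolP; apply: word_eq_sym.
- move=> /asboolP uv /asboolP vw; apply/asboolP; exact: word_eq_trans vw.
Qed.

Canonical word_eq_equiv := EquivRelPack word_eqb_equiv.

Definition presented : Type := {eq_quot word_eq_equiv}%qT.

HB.instance Definition _ := Choice.copy presented {eq_quot word_eq_equiv}%qT.

Definition word_class w : presented := (\pi_{eq_quot word_eq_equiv} w)%qT.
Definition rep (g : presented) : word X := repr (g : {eq_quot word_eq_equiv}%qT).

Definition pres_gen (x : X) : presented := word_class [:: (x, true)].

Fact word_classP u v : word_class u = word_class v <-> word_eq u v.
Proof.
by split=> [/eqmodP/asboolP //|uv]; apply/eqmodP/asboolP.
Qed.

Fact repP (g : presented) : word_class (rep g) = g.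
Proof. exact: reprK. Qed.

Fact word_eq_rep w : word_eq (rep (word_class w)) w.
Proof. by apply/word_classP; rewrite repP. Qed.

Fact word_inv_cat u v : word_inv (u ++ v) = word_inv v ++ word_inv u.
Proof. by rewrite /word_inv map_cat rev_cat. Qed.

Fact word_invK u : word_inv (word_inv u) = u.
Proof.
rewrite /word_inv map_rev revK -map_comp -[RHS]map_id.
by apply: eq_map => -[x b] /=; rewrite negbK.
Qed.

Fact word_mulV u : word_eq (u ++ word_inv u) [::].
Proof.
elim: u => [|[x b] u IHu]; first exact: word_eq_refl.
rewrite -cat1s word_inv_cat -!catA [u ++ _]catA.
apply: word_eq_trans (word_eq_cancel x b).
rewrite -[X in word_eq _ X]/([:: (x, b)] ++ ([::] ++ word_inv [:: (x, b)])).
apply: word_eq_cat; first exact: word_eq_refl.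
exact: word_eq_cat IHu (word_eq_refl _).
Qed.

Fact word_Vmul u : word_eq (word_inv u ++ u) [::].
Proof. by have := word_mulV (word_inv u); rewrite word_invK. Qed.

Fact word_eq_inv u v : word_eq u v -> word_eq (word_inv u) (word_inv v).
Proof.
move=> uv; apply: (@word_eq_trans _ (word_inv u ++ (v ++ word_inv v))).
  rewrite -[X in word_eq X]cats0; apply/word_eq_cat/word_eq_sym/word_mulV.
  exact: word_eq_refl.
rewrite catA; apply: (@word_eq_trans _ ((word_inv u ++ u) ++ word_inv v)).
  apply/word_eq_cat/word_eq_refl/word_eq_cat/word_eq_sym => //.
  exact: word_eq_refl.
exact: word_eq_cat (word_Vmul u) (word_eq_refl _).
Qed.

Definition pres_one : presented := word_class [::].
Definition pres_mul (g h : presented) := word_class (rep g ++ rep h).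
Definition pres_inv (g : presented) := word_class (word_inv (rep g)).

Fact pres_mulE u v :
  pres_mul (word_class u) (word_class v) = word_class (u ++ v).
Proof. by apply/word_classP/word_eq_cat; apply: word_eq_rep. Qed.

Fact pres_invE u : pres_inv (word_class u) = word_class (word_inv u).
Proof. by apply/word_classP/word_eq_inv/word_eq_rep. Qed.

Fact pres_mulA : associative pres_mul.
Proof.
by move=> f g h; rewrite -(repP f) -(repP g) -(repP h) !pres_mulE catA.
Qed.
Fact pres_mul1 : left_id pres_one pres_mul.
Proof. by move=> g; rewrite -(repP g) pres_mulE. Qed.
Fact pres_mulr1 : right_id pres_one pres_mul.
Proof. by move=> g; rewrite -(repP g) pres_mulE cats0. Qed.
Fact pres_mulV : left_inverse pres_one pres_inv pres_mul.
Proof.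
move=> g; rewrite -(repP g) pres_invE pres_mulE.
exact/word_classP/word_Vmul.
Qed.
Fact pres_mulrV : right_inverse pres_one pres_inv pres_mul.
Proof.
move=> g; rewrite -(repP g) pres_invE pres_mulE.
exact/word_classP/word_mulV.
Qed.

HB.instance Definition _ := isGroup.Build presented
  pres_mulA pres_mul1 pres_mulr1 pres_mulV pres_mulrV.

End Presentation.

(* Loops and multiple edges are allowed. The ends e(1) and e(-1) of an edge [e]
   are [edge_end e true] and [edge_end e false]: the sign +1 is [true]. *)
Record multigraph := Multigraph {
  vertex : finType;
  edge : finType;
  edge_end : edge -> bool -> vertex
}.

Section Graphs.
Context (Gam : multigraph).
Local Notation V := (vertex Gam).
Local Notation E := (edge Gam).
Implicit Types (A : {set V}) (D : {set E}).

Definition is_loop (e : E) : bool := edge_end e true == edge_end e false.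

Definition is_subgraph A D : Prop :=
  forall e b, e \in D -> edge_end e b \in A.

Definition adjacent D : rel V :=
  [rel u v | [exists e in D, exists b,
                (edge_end e b == u) && (edge_end e (~~ b) == v)]].

Definition connected A D : Prop :=
  (exists v, v \in A) /\ {in A &, forall u v, connect (adjacent D) u v}.

(* The oriented edge [(e, b)] goes from [edge_end e b] to
   [edge_end e (~~ b)]. *)
Definition consecutive : rel (E * bool) :=
  [rel d d' | (edge_end d.1 (~~ d.2) == edge_end d'.1 d'.2)
              && (d' != (d.1, ~~ d.2))].

(* A loop is a circuit of length 1, and two distinct edges with the same ends
   give a circuit of length 2. *)
Definition circuit D (c : seq (E * bool)) : bool :=
  [&& c != [::], all (fun d => d.1 \in D) c, cycle consecutive c
    & uniq [seq edge_end d.1 d.2 | d <- c]].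

Definition subtree A D : Prop :=
  [/\ is_subgraph A D, connected A D & forall c, ~~ circuit D c].

Definition maximal_subtree A D : Prop :=
  subtree A D /\
  forall A' D', subtree A' D' -> A \subset A' -> D \subset D' ->
    A' = A /\ D' = D.

Definition connected_graph : Prop := connected [set: V] [set: E].

(* [label e true] is the label at e(1) and [label e false] the one at e(-1). *)
Record labeling := Labeling {
  label :> E -> bool -> int;
  label_neq0 : forall e b, label e b != 0%R
}.

Definition reduced (L : labeling) : Prop :=
  forall e b, `|L e b|%N = 1%N -> is_loop e.

End Graphs.

Section GBS.
Context (Gam : multigraph) (L : labeling Gam) (T : {set edge Gam}).
Local Notation V := (vertex Gam).
Local Notation E := (edge Gam).

(* [inl v] is the generator g_v and [inr e] the generator t_e, for [e] outside
   the edge set [T] of the chosen maximal subtree. *)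
Definition gbs_gen : finType := (V + {e : E | e \notin T})%type.

Definition vertex_pow (e : E) (b : bool) : word gbs_gen :=
  word_pow (inl (edge_end e b) : gbs_gen) (L e b).

Definition stable_letter (e : {e : E | e \notin T}) : word gbs_gen :=
  [:: (inr e, true)].

Inductive gbs_rel : word gbs_gen -> word gbs_gen -> Prop :=
| gbs_rel_tree (e : E) :
    e \in T -> gbs_rel (vertex_pow e true) (vertex_pow e false)
| gbs_rel_stable (e : {e : E | e \notin T}) :
    gbs_rel (word_inv (stable_letter e) ++ vertex_pow (val e) true
               ++ stable_letter e)
            (vertex_pow (val e) false).

Definition gbs_group : groupType := presented gbs_rel.

Definition vertex_group (v : V) : set gbs_group :=
  range (expgz (pres_gen gbs_rel (inl v : gbs_gen) : gbs_group)).

Definition elliptic (a : gbs_group) : Prop :=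
  exists (v : V) (h c : gbs_group), vertex_group v c /\ a = c ^ h.

(* Meaningful when the group is not elementary: suitable [a], [m], [n] then
   exist and n/m does not depend on them, so that the choice is immaterial. *)
Definition modular (g : gbs_group) : rat :=
  xget 0%R [set q : rat | exists (a : gbs_group) (m n : int),
    [/\ elliptic a /\ a <> 1, m != 0%R /\ n != 0%R,
        expgz a m ^ g = expgz a n & q = (n%:~R / m%:~R)%R]].

End GBS.

(* Main.v *)
Require Import Defs.
From HB Require Import structures.
From mathcomp Require Import all_boot all_order all_algebra.
From mathcomp Require Import boolp classical_sets.

Set Implicit Arguments.
Unset Strict Implicit.
Unset Printing Implicit Defensive.
Import Order.TTheory GRing.Theory Num.Theory.
Local Open Scope classical_set_scope.
Local Open Scope group_scope.

(** If a group [A] contains elements [a_v], [s_e] satisfying the relations of the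
GBS-group [G], and [a_v^k] lies in the subgroup generated by [a_v^lambda] only
when [lambda] divides [k] ([lambda] being a label at [v]), then a reduced word
of [G] along a closed path goes, in the wreath product of a group [U] by [A], to
a freely reduced word in letters indexed by the cosets of the edge groups, and a
suitable unitriangular group [U] over [F_p] detects such a word. For [A] the
affine group of the rational line, where [g_v] translates by [r v] and the
dilation part of [g] is [(Delta g)^-1], this is Britton's lemma. For [A] cyclic
or dihedral, with rotation subgroup of order divisible by all the [r v] and
labels, everything is finite, and lies in the class when [Delta] takes the values
1, -1 and the primes involved belong to [rho]; elements of the vertex groups are
detected by [A] itself.

Conversely, let [q] be a prime dividing a label [lambda] at [v], and suppose that
the full power of [q] in [lambda] never divides the order of the image of [g_v]
in a group of the class. In each such image [g_v^(lambda/q)] is a power of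
[g_v^lambda], so that it commutes with all that commutes with [g_v^lambda]; in
[G] this trivializes a reduced commutator, unless the edge is a loop with a label
1 or -1 at its other end. In that case the image of [g_v] generates a subgroup
invariant under the loop, and a second edge at [v], which exists because [G] is
not solvable, gives a reduced commutator again. Hence the labels are
[rho]-numbers, and in some periodic quotient the order [o v] of [g_v] is a
multiple of every label at [v]; then [o v * `|r v|] does not depend on [v], which
makes the dilation parts equal to 1 or -1. *)

(** * Integer powers and orders *)

Definition mult_of (G H : groupType) (f : G -> H) (fM : {morph f : x y / x * y}) :
  {multiplicative G -> H} := HB.pack f (isMultiplicative.Build G H f fM).

Section Multiplicative.
Context (G H : groupType) (f : {multiplicative G -> H}).

Lemma multf1 : f 1 = 1.
Proof. by apply: (mulgI (f 1)); rewrite -gmulfM !mulg1. Qed.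

Lemma multfV : {morph f : x / x^-1}.
Proof. by move=> x; apply/esym/mulg1_eq; rewrite -gmulfM mulgV multf1. Qed.

Lemma multfX n : {morph f : x / x ^+ n}.
Proof.
move=> x; elim: n => [|n IHn]; first exact: multf1.
by rewrite !expgS gmulfM IHn.
Qed.

Lemma multfJ : {morph f : x y / x ^ y}.
Proof. by move=> x y; rewrite !gmulfM multfV. Qed.

End Multiplicative.

Section IntegerPowers.
Context (G : groupType).
Implicit Types (x y : G) (k l : int).

(** Writing integers as differences of naturals replaces the sign cases of [expgz] by a single
    identity. *)
Lemma expgzB x (m n : nat) : expgz x (m%:Z - n%:Z)%R = x ^+ m / x ^+ n.
Proof.
case: (leqP n m) => [le_nm | /ltnW le_mn].
  by rewrite subzn //= expgnFr.
rewrite -opprB subzn // -[in RHS](subnK le_mn) expgnDr invgM.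
rewrite mulgA mulgV mul1g.
by case: (n - m)%N => [|d] //=; rewrite invg1.
Qed.

Lemma expgz_natB k : exists m n : nat, k = (m%:Z - n%:Z)%R.
Proof.
case: k => n; first by exists n, 0; rewrite subr0.
by exists 0, n.+1; rewrite NegzE sub0r.
Qed.

Lemma commXVX x (m n : nat) : x ^- m * x ^+ n = x ^+ n * x ^- m.
Proof.
apply: commute_sym; apply: commuteV.
by apply: commuteX2; apply: commute_refl.
Qed.

Lemma expgzD x k l : expgz x (k + l)%R = expgz x k * expgz x l.
Proof.
have [a [b ->]] := expgz_natB k; have [c [d ->]] := expgz_natB l.
rewrite addrACA -opprD -!PoszD !expgzB [(b + d)%N]addnC !expgnDr invgM.
rewrite !mulgA; congr (_ * _); rewrite -!mulgA; congr (_ * _).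
by rewrite commXVX.
Qed.

Lemma expgz1 x : expgz x 1 = x. Proof. by []. Qed.

Lemma expgzN x k : expgz x (- k)%R = (expgz x k)^-1.
Proof. by apply/esym/mulg1_eq; rewrite -expgzD subrr. Qed.

Lemma expgzN1 x : expgz x (-1)%R = x^-1.
Proof. by rewrite expgzN. Qed.

Lemma expgzM x k l : expgz x (k * l)%R = expgz (expgz x k) l.
Proof.
have nat_case (n : nat) : expgz x (k * n%:Z)%R = expgz x k ^+ n.
  elim: n => [|n IHn]; first by rewrite mulr0.
  by rewrite intS mulrDr mulr1 expgzD IHn expgS.
case: l => n; first exact: nat_case.
by rewrite NegzE mulrN !expgzN nat_case.
Qed.

Lemma expgzMC x k l : expgz (expgz x k) l = expgz (expgz x l) k.
Proof. by rewrite -!expgzM mulrC. Qed.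

Lemma expg1z k : expgz (1 : G) k = 1.
Proof. by case: k => n /=; rewrite expg1n ?invg1. Qed.

Lemma expgVz x k : expgz x^-1 k = expgz x (- k)%R.
Proof. by rewrite -[x^-1]/(expgz x (-1)) -expgzM mulN1r. Qed.

Lemma expgzJ x y k : expgz x k ^ y = expgz (x ^ y) k.
Proof. by case: k => n /=; rewrite ?conjVg conjXg. Qed.

Lemma expgz_conj x k l : expgz x k ^ expgz x l = expgz x k.
Proof. by rewrite conjgE -expgzN -!expgzD addrCA addNr addr0. Qed.

Lemma commute_expgz x y k : commute x y -> commute x (expgz y k).
Proof.
by case: k => n cxy /=; [|apply: commuteV]; apply: commuteX.
Qed.

Lemma gmulfz (H : groupType) (f : {multiplicative G -> H}) x k :
  f (expgz x k) = expgz (f x) k.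
Proof. by case: k => n /=; rewrite ?multfV multfX. Qed.

(* [has_order x 0] means that [x] has infinite order. *)
Definition has_order x (n : nat) : Prop :=
  forall k, expgz x k = 1 <-> (n %| k)%Z.

Lemma has_order_element x n : (0 < n)%N -> has_order x n -> element_order x n.
Proof.
move=> n_gt0 ox; split=> // [|k /andP[k_gt0 ltkn] xk].
  by have /ox := dvdzz n.
have /ox : expgz x k = 1 by [].
by rewrite dvdzE /= => /(dvdn_leq k_gt0); rewrite leqNgt ltkn.
Qed.

Lemma element_has_order x n : element_order x n -> has_order x n.
Proof.
case=> n_gt0 xn min_n k; split=> [|/dvdzP[q ->]]; last first.
  by rewrite mulrC expgzM /= xn expg1z.
rewrite {1}(divz_eq k n) expgzD mulrC expgzM /= xn expg1z mul1g.
have n0 : Posz n != 0%R by rewrite -lt0n.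
have := modz_ge0 k n0; have := ltz_pmod k (d := Posz n) n_gt0.
move=> ltrn r_ge0 xr; apply/dvdz_mod0P; move: ltrn r_ge0 xr.
case: (k %% n)%Z => // -[|r] //= ltrn _ xr.
by case: (min_n r.+1).
Qed.

Lemma periodic_order x : periodic G -> exists2 n, (0 < n)%N & has_order x n.
Proof.
move=> /(_ x)[m m_gt0 xm].
pose P n := (0 < n)%N && (x ^+ n == 1).
have exP : exists n, P n by exists m; rewrite /P m_gt0 xm eqxx.
case: (ex_minnP exP) => n /andP[n_gt0 /eqP xn] min_n; exists n => //.
apply: element_has_order; split=> // k /andP[k_gt0 ltkn] /eqP xk.
by have := min_n k; rewrite /P k_gt0 xk => /(_ isT); rewrite leqNgt ltkn.
Qed.

End IntegerPowers.

Lemma has_orderJ (G : groupType) (x y : G) n : has_order (x ^ y) n <-> has_order x n.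
Proof.
have e k : (expgz (x ^ y) k = 1) <-> (expgz x k = 1).
  by rewrite -expgzJ; split=> [/eqP|->]; rewrite ?conj1g ?conjg_eq1 // => /eqP.
by split=> ox k; rewrite -ox e.
Qed.

(** * Root classes *)

Section Image.
Context (G H : groupType) (f : {multiplicative G -> H}).

Definition in_image : pred H := fun y => `[< exists x, f x = y >].

Lemma in_image_closed : group_closed in_image.
Proof.
split=> [|_ _ /asboolP[x <-] /asboolP[y <-]]; apply/asboolP.
  by exists 1; apply: multf1.
by exists (x / y); rewrite gmulfM multfV.
Qed.

(** Built as a subgroup type of [H], so that [subgroup_closed] applies to it. *)
Definition image_group : Type := {y | in_image y}.
HB.instance Definition _ := SubChoice.on image_group.
HB.instance Definition _ :=
  SubChoice_isSubGroup.Build H in_image image_group in_image_closed.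

Definition to_image (x : G) : image_group :=
  exist _ (f x) (asboolT (ex_intro _ x erefl)).

Lemma to_imageM : {morph to_image : x y / x * y}.
Proof. by move=> x y; apply: val_inj; rewrite /= gmulfM. Qed.

Lemma to_image_surj y : exists x, to_image x = y.
Proof.
case: y => y y_im; have /asboolP[x fxy] := y_im.
by exists x; apply: val_inj.
Qed.

End Image.

Section RootClass.
Context (C : group_class).
Hypothesis rootC : root_class C.

Lemma class_image (G H : groupType) (f : {multiplicative G -> H}) :
  C H -> C (image_group f).
Proof. by case: rootC => _ _ subC _ _; apply: subC. Qed.

(** [G] is isomorphic to its image, a subgroup of [H]; the inverse isomorphism comes from choice. *)
Lemma class_inj (G H : groupType) (f : {multiplicative G -> H}) :
  injective f -> C H -> C G.
Proof.
move=> f_inj CH; have := class_image f CH.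
case: rootC => isoC _ _ _ _; apply: isoC.
have [g gK] := choice (@to_image_surj _ _ f).
have Kg : cancel (to_image f) g.
  by move=> x; apply: f_inj; have [] := congr1 val (gK (to_image f x)).
have gM : {morph g : x y / x * y}.
  by move=> x y; rewrite -[in LHS](gK x) -[in LHS](gK y) -to_imageM Kg.
by exists (mult_of gM); exists (to_image f).
Qed.

(** Surjectivity costs nothing: the target can be replaced by the image. *)
Lemma residually_hom (G : groupType) :
  (forall g : G, g <> 1 ->
     exists (H : groupType) (f : {multiplicative G -> H}), C H /\ f g <> 1) ->
  residually C G.
Proof.
move=> resG g /resG[H [f [CH fg1]]].
exists (image_group f), (mult_of (@to_imageM _ _ f)); split.
- exact: class_image.
- by rewrite -subTset => y _; have [x <-] := to_image_surj y; exists x.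
- by move/(congr1 val); rewrite /= => fg; apply: fg1.
Qed.

Lemma class_ext (N G Q : groupType) (i : {multiplicative N -> G})
    (q : {multiplicative G -> Q}) :
  injective i -> (forall y, exists x, q x = y) ->
  (forall x, q x = 1 -> exists z, i z = x) -> (forall z, q (i z) = 1) ->
  C N -> C Q -> C G.
Proof.
move=> i_inj q_surj ker_im im_ker; case: rootC => _ _ _ extC _.
apply: extC i_inj _ _.
  by rewrite -subTset => y _; have [x <-] := q_surj y; exists x.
rewrite eqEsubset; split=> [_ [z _ <-]|x] /=; first exact: im_ker.
by case/ker_im=> z <-; exists z.
Qed.

(** Supplies the characteristic of the unitriangular groups used to detect reduced paths. *)
Lemma class_exists_prime :
  (forall X, C X -> periodic X) -> exists p, class_primes C p.
Proof.
move=> perC; case: rootC => _ [X CX [x x1]] _ _ _.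
have [n n_gt0 ox] := periodic_order x (perC _ CX).
have /pdivP[p p_pr dvd_pn] : (1 < n)%N.
  case: n ox n_gt0 => [|[|n]] // ox _.
  by case: x1; rewrite -[x]/(expgz x 1); apply/ox.
exists p; split=> //; exists X, x, n; split=> //.
exact: has_order_element.
Qed.

Lemma class_prime_order p : class_primes C p ->
  exists (X : groupType) (x : X), C X /\ has_order x p.
Proof.
case=> p_pr [X [x [n [CX ox dvd_pn]]]].
have n_gt0 : (0 < n)%N by case: ox.
have pn0 : Posz (n %/ p) != 0%R.
  by rewrite -lt0n divn_gt0 ?prime_gt0 // dvdn_leq.
exists X, (x ^+ (n %/ p)); split=> // k.
rewrite -[x ^+ _]/(expgz x (n %/ p)%N) -expgzM (element_has_order ox).
have -> : Posz n = (Posz (n %/ p) * Posz p)%R by rewrite -PoszM divnK.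
by rewrite dvdz_mul2l.
Qed.

End RootClass.

(** * Semidirect and wreath products *)

Record aut_action (Q K : groupType) := AutAction {
  aut_act :> Q -> K -> K;
  aut_actM : forall q, {morph aut_act q : x y / x * y};
  aut_act1 : forall x, aut_act 1 x = x;
  aut_actA : forall q r x, aut_act (q * r) x = aut_act q (aut_act r x)
}.

Lemma aut_act_1 (Q K : groupType) (a : aut_action Q K) q : a q 1 = 1.
Proof. by apply: (mulgI (a q 1)); rewrite -aut_actM !mulg1. Qed.

Definition semidirect (Q K : groupType) (a : aut_action Q K) : Type :=
  (K * Q)%type.

Section Semidirect.
Context (Q K : groupType) (a : aut_action Q K).
Implicit Types u v w : semidirect a.

Definition sd_one : semidirect a := (1, 1).
Definition sd_mul u v : semidirect a := (u.1 * a u.2 v.1, u.2 * v.2).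
Definition sd_inv u : semidirect a := (a u.2^-1 u.1^-1, u.2^-1).

Fact sd_mulA : associative sd_mul.
Proof.
by move=> u v w; rewrite /sd_mul /= aut_actM aut_actA !mulgA.
Qed.
Fact sd_mul1 : left_id sd_one sd_mul.
Proof. by case=> x q; rewrite /sd_mul /= aut_act1 !mul1g. Qed.
Fact sd_mulr1 : right_id sd_one sd_mul.
Proof. by case=> x q; rewrite /sd_mul /= aut_act_1 !mulg1. Qed.
Fact sd_mulV : left_inverse sd_one sd_inv sd_mul.
Proof.
by case=> x q; rewrite /sd_mul /= -aut_actM !mulVg aut_act_1.
Qed.
Fact sd_mulrV : right_inverse sd_one sd_inv sd_mul.
Proof.
by case=> x q; rewrite /sd_mul /= -aut_actA !mulgV aut_act1 mulgV.
Qed.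

HB.instance Definition _ := Choice.copy (semidirect a) (K * Q)%type.
HB.instance Definition _ := isGroup.Build (semidirect a)
  sd_mulA sd_mul1 sd_mulr1 sd_mulV sd_mulrV.

Definition sdl (x : K) : semidirect a := (x, 1).
Definition sdr (q : Q) : semidirect a := (1, q).
Definition sdp (u : semidirect a) : Q := u.2.

Lemma sdlM : {morph sdl : x y / x * y}.
Proof. by move=> x y; congr pair; rewrite /= ?aut_act1 ?mulg1. Qed.
Lemma sdrM : {morph sdr : q r / q * r}.
Proof. by move=> q r; congr pair; rewrite /= ?aut_act_1 ?mulg1. Qed.
Lemma sdpM : {morph sdp : u v / u * v}.
Proof. by []. Qed.

Lemma sdM u v : u * v = (u.1 * a u.2 v.1, u.2 * v.2) :> semidirect a.
Proof. by []. Qed.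
Lemma sdV u : u^-1 = (a u.2^-1 u.1^-1, u.2^-1) :> semidirect a.
Proof. by []. Qed.

Lemma sdlz x k : expgz (sdl x) k = sdl (expgz x k).
Proof. exact: esym (gmulfz (mult_of sdlM) x k). Qed.
Lemma sdrz q k : expgz (sdr q) k = sdr (expgz q k).
Proof. exact: esym (gmulfz (mult_of sdrM) q k). Qed.

Lemma class_semidirect (C : group_class) :
  root_class C -> C K -> C Q -> C (semidirect a).
Proof.
move=> rootC; apply: (class_ext rootC (i := mult_of sdlM) (q := mult_of sdpM)).
- by move=> x y [].
- by move=> q; exists (sdr q).
- by case=> x q /= ->; exists x.
- by [].
Qed.

End Semidirect.

Section Wreath.
Context (U A : groupType).

(** Right translation of the argument: a function constant on the left cosets of a subgroup is fixed
    by that subgroup. *)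
Definition shift (q : A) (f : cartesian_product (fun=> U)) :
  cartesian_product (fun _ : A => U) := fun x => f (x * q).

Fact shiftM q : {morph shift q : f g / f * g}.
Proof. by []. Qed.
Fact shift1 f : shift 1 f = f.
Proof. by apply/funext => x; rewrite /shift mulg1. Qed.
Fact shiftA q r f : shift (q * r) f = shift q (shift r f).
Proof. by apply/funext => x; rewrite /shift mulgA. Qed.

Definition shift_action := AutAction shiftM shift1 shiftA.
Definition wreath : groupType := semidirect shift_action.

Lemma class_wreath (C : group_class) :
  root_class C -> C U -> C A -> C wreath.
Proof.
move=> rootC CU CA; apply: class_semidirect => //.
case: rootC => _ _ _ _ prodC; apply: (prodC U) => // _.
by exists idfun; exists idfun.
Qed.

End Wreath.

(** * Finite solvable groups in a root class *)

Section FiniteGroups.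
From mathcomp Require Import all_fingroup all_solvable.
Context (C : group_class).
Hypothesis rootC : root_class C.

(** A generator [y] is matched with an element [x] of order [p] in a group of the class; their
    powers coincide for the same pairs of exponents, which gives an embedding. *)
Lemma class_prime_group (gT : finGroupType) (G : {group gT}) p :
  class_primes C p -> #|G| = p -> C (subg_of G).
Proof.
move=> Cp oG; have p_pr : prime p by case: Cp.
have [X [x [CX ox]]] := class_prime_order Cp.
have /cyclicP[y defG] : cyclic G by apply: prime_cyclic; rewrite oG.
have oy : #[y] = p by rewrite orderE -oG defG.
have eqE i j : x ^+ i = x ^+ j <-> y ^+ i = y ^+ j.
  have -> : x ^+ i = x ^+ j <-> expgz x (i%:Z - j%:Z)%R = 1%g.
    by rewrite expgzB; split=> [->|/monoid.divg1_eq //]; rewrite monoid.mulgV.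
  rewrite ox -eqz_mod_dvd !modz_nat eqz_nat -oy -eq_expg_mod_order.
  by split=> /eqP.
have exG (z : subg_of G) : exists i, sgval z = y ^+ i.
  by apply/cycleP; rewrite -defG subgP.
have [e eE] := choice exG.
have fM : {morph (fun z => x ^+ e z) : z w / z * w >-> monoid.mul z w}.
  move=> z w; rewrite -monoid.expgnDr; apply/eqE.
  by rewrite -eE expgD -!eE.
apply: (class_inj rootC (f := mult_of fM)) CX.
by move=> z w /= /eqE; rewrite -!eE; apply: val_inj.
Qed.

(** Induction on the order: a non-trivial solvable group has a normal subgroup of prime index, and
    the class is closed under extensions. *)
Lemma class_solvable_group (gT : finGroupType) (G : {group gT}) :
  (forall p, prime p -> (p %| #|G|)%N -> class_primes C p) ->
  solvable G -> C (subg_of G).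
Proof.
have [n] := ubnP #|G|; elim: n => // n IHn in gT G * => ltGn rhoG solG.
have [G1|ntG] := eqsVneq G 1.
  (* Here [p] is a group of the class, into which the trivial group embeds. *)
  have [p Cp] : exists X, C X by case: rootC => _ [X CX _]; exists X.
  have triv (x y : subg_of G) : x = y.
    apply: val_inj; transitivity (1 : gT); [|apply: esym];
    by apply/set1gP; rewrite -G1 subgP.
  have oneM : {morph (fun _ : subg_of G => 1 : p) : x y / monoid.mul x y}.
    by move=> x y; rewrite monoid.mulg1.
  by apply: (class_inj rootC (f := mult_of oneM)) => // x y _; apply: triv.
have [H nsHG prGH] := sol_prime_factor_exists solG ntG.
have [sHG nHG] := andP nsHG.
have inM : {morph (fun x : subg_of H => subg G (sgval x)) : x y / monoid.mul x y}.
  move=> x y; apply: (can_inj sgvalK).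
  have sHGP z : sgval (z : subg_of H) \in G by rewrite (fintype.subsetP sHG) ?subgP.
  by rewrite [RHS](sgvalM (finset.in_setT _) (finset.in_setT _)) !subgK.
have quoM : {morph (fun x : subg_of G => subg (G / H) (coset H (sgval x))) :
               x y / monoid.mul x y}.
  move=> x y; apply: (can_inj sgvalK).
  have quoP z : coset H (sgval (z : subg_of G)) \in G / H.
    by rewrite mem_quotient ?subgP.
  rewrite [RHS](sgvalM (finset.in_setT _) (finset.in_setT _)) !subgK //.
  by rewrite -morphM ?(fintype.subsetP nHG) ?subgP.
apply: (class_ext rootC (i := mult_of inM) (q := mult_of quoM)).
- move=> x y /= /(congr1 sgval); rewrite !subgK ?(fintype.subsetP sHG) ?subgP //.
  exact: val_inj.
- move=> y; have /morphimP[x Nx Gx defy] := subgP y.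
  by exists (subg G x); rewrite /= subgK // -defy sgvalK.
- move=> x /= /(congr1 sgval); rewrite subgK ?mem_quotient ?subgP // => cx1.
  have Hx : sgval x \in H.
    by rewrite -(ker_coset H); apply/kerP; rewrite ?(fintype.subsetP nHG) ?subgP.
  by exists (subg H (sgval x)); rewrite /= subgK // sgvalK.
- move=> z /=; rewrite subgK ?(fintype.subsetP sHG) ?subgP // coset_id ?subgP //.
  exact: (morph1 (subg_morphism _)).
- apply: IHn (solvableS sHG solG).
    rewrite -ltnS; apply: leq_ltn_trans ltGn; apply: proper_card.
    rewrite properE sHG; apply: contraL prGH => sGH.
    by rewrite -indexgI (finset.setIidPl sGH) indexgg.
  by move=> p p_pr /dvdn_trans/(_ (cardSg sHG)); apply: rhoG.
- apply: (@class_prime_group _ _ #|G : H|).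
    by apply: rhoG => //; apply: dvdn_indexg.
  by rewrite card_quotient.
Qed.

End FiniteGroups.

(** * Free words in unitriangular groups *)

Definition signed (U : groupType) (x : U) (b : bool) : U := if b then x else x^-1.

Definition word_value (K : Type) (U : groupType) (h : K -> U) (w : word K) : U :=
  \prod_(x <- w) signed (h x.1) x.2.

Section UnitriangularMatrices.
From mathcomp Require Import all_fingroup all_solvable.
Local Open Scope ring_scope.
Context (p n : nat).
Hypothesis p_pr : prime p.
Local Notation M := 'M['F_p]_n.+1.

Definition upper (k : nat) (A : M) :=
  [forall i : 'I_n.+1, forall j : 'I_n.+1, (A i j != 0) ==> (i + k <= j)%N].

Lemma upperP k (A : M) : reflect (forall i j : 'I_n.+1, (j < i + k)%N -> A i j = 0) (upper k A).
Proof.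
apply: (iffP idP) => [uA i j | uA].
  move/forallP/(_ i)/forallP/(_ j): uA; rewrite implyNb ltnNge.
  by case/predU1P=> // ->.
apply/forallP=> i; apply/forallP=> j; rewrite implyNb leqNgt.
by case: ltnP => [/uA-> | _]; rewrite ?eqxx ?orbT.
Qed.

Lemma upperD k A B : upper k A -> upper k B -> upper k (A + B).
Proof.
by move=> /upperP uA /upperP uB; apply/upperP => i j lt; rewrite mxE uA ?uB ?addr0.
Qed.

Lemma upperM k l A B : upper k A -> upper l B -> upper (k + l) (A * B).
Proof.
move=> /upperP uA /upperP uB; apply/upperP => i j lt.
rewrite mxE big1 // => m _; case: (ltnP m (i + k)) => [/uA->|le]; first by rewrite mul0r.
by rewrite uB ?mulr0 //; apply: leq_trans lt _; rewrite addnA leq_add2r.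
Qed.

Lemma upperX k A : upper 1 A -> upper k (A ^+ k).
Proof.
move=> uA; elim: k => [|k IHk]; last by rewrite exprS -add1n upperM.
apply/upperP=> i j; rewrite addn0 expr0 mxE => ltji.
by case: eqP ltji => // ->; rewrite ltnn.
Qed.

Lemma upper_eq0 (A : M) : upper n.+1 A -> A = 0.
Proof.
move=> /upperP uA; apply/matrixP=> i j; rewrite mxE uA //.
by rewrite (leq_trans (ltn_ord j)) ?leq_addl.
Qed.

Definition unitriangular : {set {unit M}} := ([set u : {unit M} | upper 1 (val u - 1)])%SET.

Fact unitriangular_group_set : group_set unitriangular.
Proof.
apply/group_setP; split=> [|u v]; rewrite !inE ?subrr.
  by apply/upperP=> i j _; rewrite mxE.
move=> uu uv; have -> : val (u * v)%g - 1 =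
    (val u - 1) * (val v - 1) + ((val u - 1) + (val v - 1)).
  rewrite -[val (u * v)%g]/(val u * val v) -{1}(subrK 1 (val u)) -{1}(subrK 1 (val v)).
  by rewrite mulrDl mulrDr mul1r mulr1 !addrA addrK.
apply: upperD; last exact: upperD.
have := upperM uu uv; move=> /upperP uuv; apply/upperP => i j lt; apply: uuv.
by apply: leq_trans lt _; rewrite leq_add2l.
Qed.
Canonical unitriangular_group := Group unitriangular_group_set.

(** In characteristic [p], [(1 + N)^(p^k) = 1 + N^(p^k)], and [N^(n+1) = 0] with [p^(n+1) > n+1]. *)
Lemma unitriangular_exp u : u \in unitriangular -> (u ^+ (p ^ n.+1) = 1)%g.
Proof.
rewrite inE => uu; apply: val_inj; rewrite /= FinRing.val_unitX.
have pM : p \in [pchar M] by rewrite pchar_lalg pchar_Fp.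
have -> : val u = 1 + (val u - 1) by rewrite addrC subrK.
have -> : forall k, (1 + (val u - 1)) ^+ (p ^ k) = 1 + (val u - 1) ^+ (p ^ k).
  elim=> // k IHk; rewrite expnSr !exprM IHk -!(pFrobenius_autE pM).
  rewrite pFrobenius_autD_comm ?pFrobenius_aut1 //; exact: commr_sym (commr1 _).
rewrite (_ : _ ^+ _ = 0) ?addr0 //; apply: upper_eq0.
have := upperX (p ^ n.+1) uu => /upperP uX; apply/upperP=> i j lt; apply: uX.
apply: leq_trans lt _; rewrite leq_add2l ltnW // ltn_expl //; exact: prime_gt1.
Qed.

Lemma unitriangular_pgroup : p.-group unitriangular.
Proof.
apply/pgroupP=> q q_pr /(Cauchy q_pr)[u uu ou].
have := unitriangular_exp uu; move/eqP; rewrite -order_dvdn ou.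
by rewrite Euclid_dvdX // => /andP[]; rewrite dvdn_prime2.
Qed.

Section SpreadWord.
Context (K : eqType) (k0 : K) (w : seq (K * bool)).
Hypothesis size_w : size w = n.
Hypothesis w_spread : sorted (fun x y => x.1 != y.1) w.
Local Notation key i := (nth (k0, true) w i).1.

(** The sum of the elementary matrices [E_(i,i+1)] over the positions [i] at which [w] has the key
    [y]. *)
Definition step_mx (y : K) : M :=
  \matrix_(i, j) ((j == i.+1 :> nat) && (key i == y))%:R.

Lemma step_upper y : upper 1 (step_mx y).
Proof.
apply/upperP=> i j; rewrite mxE addn1 => lt.
by rewrite (ltn_eqF lt).
Qed.

(** A non-zero entry of the square would need the key [y] at two adjacent positions, against
    [w_spread]. *)
Lemma step_sqr0 y : step_mx y * step_mx y = 0.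
Proof.
apply/matrixP=> i k; rewrite !mxE big1 // => j _; rewrite !mxE -natrM mulnb.
case: andP => // -[/andP[/eqP ji /eqP ki] /andP[/eqP kj /eqP kj']].
have lt : (i.+1 < size w)%N by rewrite size_w -ji -ltnS -kj.
have := sortedP (k0, true) w_spread i lt; rewrite ki -ji kj'.
by rewrite eqxx.
Qed.

Lemma step_unit y : 1 + step_mx y \is a GRing.unit.
Proof.
apply/unitrP; exists (1 - step_mx y); split.
  by rewrite mulrDr mulr1 mulrBl mul1r step_sqr0 subr0 subrK.
by rewrite mulrBr mulr1 mulrDl mul1r step_sqr0 addr0 addrK.
Qed.

Lemma step_inv y : (1 + step_mx y)^-1 = 1 - step_mx y.
Proof.
apply: (mulrI (step_unit y)); rewrite mulrV ?step_unit //.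
by rewrite mulrBr mulr1 mulrDl mul1r step_sqr0 addr0 addrK.
Qed.

Definition step_elt (y : K) : {unit M} := FinRing.unit _ (step_unit y).

Lemma step_elt_in y : step_elt y \in unitriangular.
Proof. by rewrite inE /= addrAC subrr add0r step_upper. Qed.

Definition step_val (x : K * bool) : M :=
  if x.2 then 1 + step_mx x.1 else 1 - step_mx x.1.

(* In the top row of a product of [k] factors, the last non-zero entry is the
   one in column [k]. *)
Lemma step_row k : (k <= n)%N ->
  let A := \prod_(x <- take k w) step_val x in
  (forall j : 'I_n.+1, (k < j)%N -> A ord0 j = 0) /\
  (forall j : 'I_n.+1, k = j -> A ord0 j != 0).
Proof.
elim: k => [_ | k IHk lt_kn] /=.
  rewrite take0 big_nil; split=> j; rewrite mxE; first by case: j => -[].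
  by move=> j0; have -> : ord0 == j; [apply/eqP/val_inj | rewrite oner_neq0].
have [Az An] := IHk (ltnW lt_kn).
rewrite (take_nth (k0, true)) ?size_w // -cats1 big_cat big_seq1.
set A := \prod_(x <- _) _ in Az An *; set x := nth _ _ _.
pose e : 'F_p := if x.2 then 1 else -1.
have e0 : e != 0 by rewrite /e; case: ifP; rewrite ?oppr_eq0 oner_neq0.
have -> : step_val x = 1 + e *: step_mx x.1.
  by rewrite /step_val /e; case: x.2; rewrite ?scaleN1r ?scale1r.
have entry j : (A * (1 + e *: step_mx x.1)) ord0 j =
    A ord0 j + e * \sum_i A ord0 i * step_mx x.1 i j.
  by rewrite mulrDr mulr1 -scalerAr !mxE.
split=> j ltkj; rewrite entry.
  rewrite Az ?(ltnW ltkj) // add0r big1 ?mulr0 // => i _.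
  rewrite mxE; case: (eqVneq (j : nat) i.+1) => [ji | _]; last by rewrite mulr0.
  by rewrite Az ?mul0r // -ltnS -ji.
(* In column [k+1] only the term of index [k] survives, and there [step_mx] has entry 1 because [x]
   is the letter at position [k]. *)
have ltk : (k < n.+1)%N by rewrite ltnW.
rewrite Az -?ltkj // add0r (bigD1 (Ordinal ltk)) //= big1 ?addr0 => [|i ik].
  by rewrite mxE /= -ltkj eqxx eqxx mulr1 mulf_neq0 ?An.
rewrite mxE -ltkj eqSS eq_sym -(inj_eq val_inj) /= in ik *.
by rewrite (negbTE ik) mulr0.
Qed.

End SpreadWord.
End UnitriangularMatrices.

(* Replacing each letter [x] by [(x, true)(x, false)] makes adjacent letters of
   a freely reduced word distinct, so that [step_elt] applies. *)
Definition split_letter (K : Type) (x : K * bool) : seq ((K * bool) * bool) :=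
  if x.2 then [:: ((x.1, true), true); ((x.1, false), true)]
  else [:: ((x.1, false), false); ((x.1, true), false)].

Lemma split_spread (K : eqType) (w : seq (K * bool)) :
  sorted (fun x y => (x.1 == y.1) ==> (x.2 == y.2)) w ->
  sorted (fun x y => x.1 != y.1) (flatten [seq split_letter x | x <- w]).
Proof.
case: w => //= x w; elim: w x => [|y w IHw] x /=.
  by rewrite cats0; case: x => k [] //=; rewrite xpair_eqE eqxx.
case/andP=> xy /IHw; case: x xy => k b; case: y => l c /=.
case: (eqVneq k l) => [<-|kl] /=; last first.
  move=> _; rewrite /split_letter /=; case: b; case: c => /=;
  by rewrite ?xpair_eqE ?(negbTE kl) ?andbF ?eqxx.
by move=> /eqP->; rewrite /split_letter; case: c => /=; rewrite !xpair_eqE eqxx.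
Qed.

Lemma word_value_split (K : Type) (U : groupType) (h : K * bool -> U) (w : word K) :
  word_value (fun k => h (k, true) * h (k, false)) w =
  word_value h (flatten [seq split_letter x | x <- w]).
Proof.
rewrite /word_value; elim: w => [|[k b] w IHw] /=; first by rewrite !big_nil.
rewrite big_cons big_cat /= IHw; congr (_ * _).
by case: b; rewrite /split_letter /= !big_cons big_nil mulg1 //= invgM.
Qed.

Section FreeWordSeparation.
From mathcomp Require Import all_fingroup all_solvable.

(** Each letter goes to the product of the two unipotents attached to its split copies. By
    [step_row] the matrix of the word has a non-zero top right entry, unlike the identity. The
    unitriangular group is a finite [p]-group, hence solvable and in the class. *)
Lemma free_word_separation (C : group_class) (p : nat) (K : eqType) (w : word K) :
  root_class C -> class_primes C p -> w <> [::] ->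
  sorted (fun x y => (x.1 == y.1) ==> (x.2 == y.2)) w ->
  exists (U : groupType) (h : K -> U), C U /\ word_value h w <> monoid.one.
Proof.
move=> rootC Cp w0 red_w; have p_pr : prime p by case: Cp.
set w' := flatten [seq split_letter x | x <- w].
have w'_spread : sorted (fun x y => x.1 != y.1) w' := split_spread red_w.
have [k0 w'0] : exists k0 : K * bool, (0 < size w')%N.
  by case: (w) w0 @w' {w'_spread red_w} => // -[k b] v _; exists (k, b); case: b.
pose T : {group {unit 'M['F_p]_((size w').+1)}} := unitriangular_group p (size w').
have stepT y : step_elt p k0 erefl w'_spread y \in T by exact: step_elt_in.
pose h (y : K * bool) : subg_of T := subg T (step_elt p k0 erefl w'_spread y).
exists (subg_of T), (fun k => monoid.mul (h (k, true)) (h (k, false))); split.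
  apply: (class_solvable_group rootC).
    move=> q q_pr dvd_q; have /pgroupP/(_ _ q_pr dvd_q)/eqP-> // :=
      unitriangular_pgroup (size w') p_pr.
  exact: pgroup_sol (unitriangular_pgroup _ p_pr).
rewrite word_value_split -/w' => /(congr1 (fun x : subg_of T => FinRing.uval (sgval x))).
have -> : FinRing.uval (sgval (word_value h w')) =
    (\prod_(x <- take (size w') w') step_val p (size w') k0 w' x)%R.
  rewrite take_size /word_value.
  apply: (big_ind2 (fun (x : subg_of T) y => FinRing.uval (sgval x) = y)) => //.
    by move=> x _ y _ <- <-.
  move=> x _; rewrite /step_val /signed; case: x.2; rewrite /h.
    by rewrite subgK; [|apply: stepT].
  rewrite -[FinRing.uval _]/((FinRing.uval (sgval (subg T _)))^-1)%R subgK.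
    exact: step_inv.
  exact: stepT.
have [_ /(_ ord_max erefl)] := step_row p k0 (erefl (size w')) (leqnn _).
move=> /[swap] ->; rewrite -[FinRing.uval _]/(1%R : 'M['F_p]_((size w').+1)) mxE.
have -> : (ord0 == ord_max :> 'I_(size w').+1) = false.
  by apply/negP => /eqP/(congr1 val)/=; case: (size w') w'0.
by rewrite eqxx.
Qed.

End FreeWordSeparation.

(** * Presentations and path words *)

Section WordValue.
Context (X : Type) (H : groupType) (h : X -> H).

Lemma word_value_cat (u v : word X) :
  word_value h (u ++ v) = word_value h u * word_value h v.
Proof. exact: big_cat. Qed.

Lemma word_value_gen x b : word_value h [:: (x, b)] = signed (h x) b.
Proof. exact: big_seq1. Qed.

Lemma word_value_pow x k : word_value h (word_pow x k) = expgz (h x) k.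
Proof.
have nseqE n b : word_value h (nseq n (x, b)) = signed (h x) b ^+ n.
  elim: n => [|n IHn]; first exact: big_nil.
  by rewrite expgS -IHn -word_value_gen -word_value_cat.
by case: k => n; rewrite /word_pow nseqE //= expVgn.
Qed.

End WordValue.

Section Presented.
Context (X : choiceType) (R : word X -> word X -> Prop).

Lemma presented_hom (H : groupType) (h : X -> H) :
  (forall u v, R u v -> word_value h u = word_value h v) ->
  exists f : {multiplicative presented R -> H}, forall x, f (pres_gen R x) = h x.
Proof.
move=> hR; have hE u v : word_eq R u v -> word_value h u = word_value h v.
  elim=> {u v} // [u v w _ -> _ -> | u u' v v' _ uu' _ vv' | x b] //.
    by rewrite !word_value_cat uu' vv'.
  rewrite /word_value !big_cons !big_nil mulg1 /=.
  by case: b => /=; rewrite ?mulgV ?mulVg.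
have fM : {morph (fun g : presented R => word_value h (rep g)) : g g' / g * g'}.
  by move=> g g'; rewrite -word_value_cat; apply/hE/word_eq_rep.
exists (mult_of fM) => x /=.
by rewrite (hE _ [:: (x, true)]) ?word_value_gen //; apply: word_eq_rep.
Qed.

Lemma presented_ind (P : presented R -> Prop) :
  P 1 -> (forall x y, P x -> P y -> P (x * y)) ->
  (forall x, P (pres_gen R x)) -> (forall x, P (pres_gen R x)^-1) ->
  forall g, P g.
Proof.
move=> P1 PM Pg PV g; rewrite -(repP g); elim: (rep g) => [|[x b] w IHw] //.
rewrite -cat1s -[word_class _ _]pres_mulE; apply: PM => //.
case: b; first exact: Pg.
have := PV x; rewrite -[(pres_gen R x)^-1]/(pres_inv (pres_gen R x)).
by rewrite /pres_gen pres_invE.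
Qed.

End Presented.

Section Paths.
Context (Gam : multigraph) (L : labeling Gam).
Local Notation V := (vertex Gam).
Local Notation E := (edge Gam).

Definition dart : Type := (E * bool)%type.
Implicit Types (d : dart) (v w : V) (l : seq (int * (E * bool))) (k : int).

Definition src d : V := edge_end d.1 d.2.
Definition tgt d : V := edge_end d.1 (~~ d.2).
Definition lam d : int := L d.1 d.2.
Definition rdart d : (E * bool)%type := (d.1, ~~ d.2).

(* [a] and [s] satisfy the defining relations of the GBS-group, with a stable
   letter for every edge, including those of the maximal subtree. *)
Definition is_rep (H : groupType) (a : V -> H) (s : E -> H) : Prop :=
  forall e, expgz (a (edge_end e true)) (L e true) ^ s e =
            expgz (a (edge_end e false)) (L e false).

Definition dart_val (H : groupType) (s : E -> H) d : H := signed (s d.1) d.2.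

Lemma rep_dart (H : groupType) (a : V -> H) (s : E -> H) : is_rep a s ->
  forall d, expgz (a (src d)) (lam d) ^ dart_val s d = expgz (a (tgt d)) (lam (rdart d)).
Proof. by move=> rep_s [e []]; rewrite /dart_val /= -rep_s ?conjgK. Qed.

(* The list [(k1, d1), ..., (kn, dn)] with last exponent [k] stands for the
   product [a^k1 s_d1 a^k2 ... a^kn s_dn a^k] along the path [d1, ..., dn]. *)
Fixpoint path_val (H : groupType) (a : V -> H) (s : E -> H) v l k : H :=
  if l is (k', d) :: l' then
    expgz (a v) k' * (dart_val s d * path_val a s (tgt d) l' k)
  else expgz (a v) k.

Fixpoint is_path v l w : bool :=
  if l is (_, d) :: l' then (src d == v) && is_path (tgt d) l' w else v == w.

(** A pinch is a subword [s_d a^k s_d^-1] with [lam (rdart d)] dividing [k]; the edge relation turns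
    it into a power of the generator at [src d]. *)
Definition no_pinch (x y : int * (E * bool)) : bool :=
  ~~ ((y.2 == rdart x.2) && (lam y.2 %| y.1)%Z).

Definition reduced_path l : bool := sorted no_pinch l.

(** Induction from the right: once the tail is reduced, a pinch can occur only at its head, and
    removing it merges the neighbouring exponents. *)
Lemma reduce_path (H : groupType) (a : V -> H) (s : E -> H) : is_rep a s ->
  forall l v w k, is_path v l w -> exists l' k',
    [/\ is_path v l' w, reduced_path l' & path_val a s v l' k' = path_val a s v l k].
Proof.
move=> rep_s; elim=> [|[k1 d] l IHl] v w k /=; first by exists [::], k.
case/andP=> /eqP sd /IHl -/(_ k)[l' [k' [l'w red_l' <-]]].
case: l' l'w red_l' => [|[k2 d2] l2] /= l'w red_l'.
  by exists [:: (k1, d)], k'; rewrite /= sd eqxx.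
case/andP: l'w => /eqP sd2 l2w.
case: (boolP (no_pinch (k1, d) (k2, d2))) => [np | ].
  exists [:: (k1, d), (k2, d2) & l2], k'.
  by rewrite /= sd sd2 !eqxx /= l2w /reduced_path /= np.
rewrite negbK /= => /andP[/eqP def_d2 /dvdzP[j def_k2]].
have td2 : tgt d2 = v by rewrite def_d2 /tgt /= negbK.
have key : expgz (a v) k1 * (dart_val s d * (expgz (a (tgt d)) k2 * dart_val s d2)) =
    expgz (a v) (k1 + lam d * j)%R.
  have -> : dart_val s d2 = (dart_val s d)^-1.
    by rewrite def_d2 /dart_val /=; case: (d.2); rewrite /= ?invgK.
  rewrite expgzD; congr (_ * _).
  rewrite def_k2 def_d2 mulrC [in LHS]expgzM -(rep_dart rep_s) -expgzJ -expgzM sd.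
  by rewrite conjgE !mulgA mulgV mul1g mulgK.
case: l2 l2w red_l' => [|[k3 d3] l3] /= l2w red_l'.
  exists [::], (k1 + lam d * j + k')%R; split=> //=; first by rewrite -td2.
  by rewrite expgzD td2 -key !mulgA.
(* Changing the first exponent keeps the path reduced, since [no_pinch] does not read the exponent
   of its first argument. *)
exists ((k1 + lam d * j + k3, d3) :: l3)%R, k'; split=> //=; first by rewrite -td2.
  by case/andP: red_l' => _; case: (l3).
by rewrite expgzD td2 -key !mulgA.
Qed.

(** * Separation of reduced paths in wreath products *)

Section Separation.
Context (C : group_class) (p : nat) (A : groupType) (a : V -> A) (s : E -> A).
Hypotheses (rootC : root_class C) (Cp : class_primes C p) (rep_s : is_rep a s).
Hypothesis faithful : forall d k j,
  expgz (a (src d)) k = expgz (a (src d)) (lam d * j) -> (lam d %| k)%Z.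

Definition coset (e : E) (x : A) : set A :=
  [set y | exists j, y = x * expgz (a (edge_end e true)) (L e true * j)].

Lemma coset_eq e x y j : y = x * expgz (a (edge_end e true)) (L e true * j) ->
  coset e y = coset e x.
Proof.
move=> ->; rewrite eqEsubset; split=> _ [i ->].
  by exists (j + i)%R; rewrite mulrDr expgzD mulgA.
by exists (i - j)%R; rewrite -mulgA -expgzD -mulrDr addrC subrK.
Qed.

Lemma coset_eqP e x y : coset e y = coset e x ->
  exists j, y = x * expgz (a (edge_end e true)) (L e true * j).
Proof.
move=> exy; have cy : coset e y y by exists 0%R; rewrite mulr0 mulg1.
by move: cy; rewrite exy.
Qed.

(* Reading a path in the free group on the pairs (edge, coset): the coset
   records the part of the value in [A] accumulated before the edge. *)
Definition letter (x : A) (d : E * bool) : (E * {classic set A}) * bool :=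
  ((d.1, coset d.1 (if d.2 then x else x / s d.1)), d.2).

Fixpoint letters x v l : word (E * {classic set A}) :=
  if l is (k, d) :: l' then
    let y := x * expgz (a v) k in
    letter y d :: letters (y * dart_val s d) (tgt d) l'
  else [::].

(** Two cancelling adjacent letters come from opposite darts with the same coset. Then the power of
    the vertex generator between them lies in the edge subgroup, and [faithful] turns this into a
    pinch. *)
Lemma letters_reduced x v l w : is_path v l w -> reduced_path l ->
  sorted (fun x y => (x.1 == y.1) ==> (x.2 == y.2)) (letters x v l).
Proof.
rewrite /reduced_path; elim: l x v => [|[k d] [|[k' d'] l] IHl] x v //=.
case/andP=> _ lw /andP[np red_l]; apply/andP; split; last first.
  exact: (IHl (x * expgz (a v) k * dart_val s d) (tgt d)).
apply/implyP=> /eqP[ed ec]; apply/eqP; apply: contraNeq np => d2.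
have def_d' : d' = rdart d.
  by case: d' d ed d2 {lw ec red_l IHl} => [e' []] [e []] //= ->.
rewrite /= def_d' eqxx /=; move: ec; rewrite def_d' /=.
have faith j : expgz (a (tgt d)) k' = expgz (a (tgt d)) (lam (rdart d) * j) ->
  (lam (rdart d) %| k')%Z by exact: (@faithful (rdart d) k' j).
case: d faith {def_d' ed d2 lw red_l IHl} => e [] /= faith.
  move=> /esym/coset_eqP[j]; rewrite -!mulgA => /mulgI/mulgI ej; apply: (faith j).
  rewrite expgzM -(rep_dart rep_s (e, true)) -expgzJ -expgzM -ej /dart_val /=.
  by rewrite conjgE !mulgA mulVg mul1g mulgVK.
by move=> /esym/coset_eqP[j /mulgI ej]; apply: (faith j).
Qed.

Lemma path_separation l v w k : is_path v l w -> reduced_path l -> l <> [::] ->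
  exists (U : groupType) (t : E -> wreath U A),
    [/\ C U, is_rep (fun v => sdr (shift_action U A) (a v)) t &
        path_val (fun v => sdr (shift_action U A) (a v)) t v l k <> 1].
Proof.
move=> lw red_l l0.
have w0 : letters 1 v l <> [::] by case: (l) l0 => // -[].
have [U [h [CU hw]]] := free_word_separation rootC Cp w0 (letters_reduced 1 lw red_l).
(* [f e] is constant on the cosets of the edge subgroup, so it is fixed by that subgroup and the
   edge relation lifts to the wreath product. *)
pose f e : cartesian_product (fun _ : A => U) := fun x => h (e, coset e x).
pose t e : wreath U A := (f e, s e).
exists U, t; split=> // [e | ].
  have main : sdr (shift_action U A) (expgz (a (edge_end e true)) (L e true)) * t e =
      t e * sdr (shift_action U A) (expgz (a (edge_end e false)) (L e false)).
    have shift_1 q : shift q 1 = 1 :> cartesian_product (fun _ : A => U) by [].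
    rewrite !sdM /= shift_1 mulg1 -rep_s conjgE !mulgA mulgV !mul1g.
    congr pair; apply/funext => x; rewrite /shift /f (@coset_eq e x _ 1) //.
    by rewrite mulr1.
  by rewrite !sdrz conjgE main mulgA mulVg mul1g.
move=> /(congr1 (fun u : wreath U A => u.1 1)) eq1; apply: hw; rewrite -{}[RHS]eq1.
(* Generalized to any starting point [x]: the base coordinate of the path value, taken at [x], is
   the value of [letters x v l]. *)
elim: l v 1 {lw red_l l0 w0} => [|[k' d] l IHl] v x /=.
  by rewrite sdrz /word_value big_nil.
rewrite /word_value big_cons -/(word_value h _) IHl sdrz /=.
set y := x * _; have d2 : (dart_val t d).2 = dart_val s d by case: (d) => e [].
have d1 : signed (h (letter y d).1) d.2 = (dart_val t d).1 y by case: (d) => e [].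
by rewrite d1 -d2; apply: esym (mul1g _).
Qed.

End Separation.
End Paths.

(** * Forests and spanning trees *)

Section Forests.
Context (Gam : multigraph).
Local Notation V := (vertex Gam).
Local Notation E := (edge Gam).
Local Notation src := (@src Gam).
Local Notation tgt := (@tgt Gam).
Implicit Types (D : {set E}) (d : E * bool).

Lemma adjacent_dart D d : d.1 \in D -> adjacent D (src d) (tgt d).
Proof.
move=> dD; apply/existsP; exists d.1; rewrite dD /=.
by apply/existsP; exists d.2; rewrite !eqxx.
Qed.

Lemma adjacentP D x y : adjacent D x y ->
  exists d, [/\ d.1 \in D, src d = x & tgt d = y].
Proof.
case/existsP=> e /andP[eD /existsP[b /andP[/eqP ex /eqP ey]]].
by exists (e, b).
Qed.

Lemma adjacent_sym D : symmetric (adjacent D).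
Proof.
suff sub x y : adjacent D x y -> adjacent D y x by move=> x y; apply/idP/idP; apply: sub.
case/adjacentP=> d [dD <- <-].
by have := @adjacent_dart D (rdart d) dD; rewrite /tgt /src /= negbK.
Qed.

Lemma connect_adjacent_sym D : connect_sym (adjacent D).
Proof. exact: sym_connect_sym (adjacent_sym D). Qed.

Lemma circuitS D D' c : D \subset D' -> circuit D c -> circuit D' c.
Proof.
move=> /fintype.subsetP sDD' /and4P[c0 cD cc uc]; apply/and4P; split=> //.
by apply: sub_all cD => d; apply: sDD'.
Qed.

Lemma path_darts D x q : path (adjacent D) x q -> exists c : seq (E * bool),
  [/\ all (fun d => d.1 \in D) c, map src c = belast x q & map tgt c = q].
Proof.
elim: q x => [|y q IHq] x /=; first by exists [::].
case/andP=> /adjacentP[d [dD <- dy]] /IHq[c [cD sc tc]].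
by exists (d :: c); rewrite /= dD cD sc tc dy.
Qed.

(** Turning back would repeat a vertex or put the edge of [d0] in [D]. The disjunction on [d] serves
    the induction: the walk starts with [d0], then its last dart lies in [D] and its source has been
    left behind. *)
Lemma path_consecutive D d0 d x q c : d0.1 \notin D ->
  d = d0 \/ d.1 \in D /\ src d \notin x :: q ->
  tgt d = x -> src d0 = last x q -> uniq (x :: q) ->
  all (fun d => d.1 \in D) c -> map src c = belast x q -> map tgt c = q ->
  path (@consecutive Gam) d (rcons c d0).
Proof.
move=> d0D; elim: q x d c => [|y q IHq] x d [|d1 c] //= dP dx lq uq cD.
  move=> _ _; rewrite andbT /consecutive /= -/(tgt d) -/(src d0) dx lq eqxx /=.
  case: dP => [-> | [dD _]]; first by case: (d0) => e b; rewrite xpair_eqE eqxx; case: b.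
  by apply: contraNneq d0D => ->.
case=> sd1 sc [td1 tc]; case/andP: cD => d1D cD; case/and3P: uq => xq yq uq.
apply/andP; split.
  rewrite /consecutive /= -/(tgt d) -/(src d1) dx sd1 eqxx /=.
  case: dP => [-> | [dD dq]]; last first.
    apply: contraNneq dq => def_d1; rewrite !in_cons -td1 def_d1.
    by rewrite /tgt /= negbK eqxx orbT.
  by apply: contraNneq d0D => def_d1; move: d1D; rewrite def_d1.
apply: (IHq y) => //=; last by rewrite yq.
by right; rewrite d1D sd1.
Qed.

Lemma circuit_close D e : e \notin D ->
  connect (adjacent D) (edge_end e true) (edge_end e false) ->
  exists c, circuit (e |: D) c.
Proof.
move=> eD /connectP[q0 path_q0 lq0].
case/shortenP: path_q0 lq0 => q path_q uq _ lq.
have [c [cD sc tc]] := path_darts path_q.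
exists ((e, false) :: c); apply/and4P; split=> //=.
- rewrite finset.setU11; apply: sub_all cD => d; exact: finset.setU1r.
- by apply: (@path_consecutive D _ _ (edge_end e true) q) => //; left.
- by rewrite -/(map src c) sc {1}lq -rcons_uniq -lastI.
Qed.

(** Induction on the edges. Once [e] is removed its ends are not connected, for a circuit would
    close otherwise, so [q] can be corrected by a left factor on the component of one end. [P]
    confines the values to a subgroup. *)
Lemma forest_potential D (H : groupType) (s : E -> H) (P : H -> Prop) :
  (forall c, ~~ circuit D c) ->
  P 1 -> (forall x y, P x -> P y -> P (x * y)) -> (forall x, P x -> P x^-1) ->
  (forall e, P (s e)) ->
  exists q : V -> H, (forall v, P (q v)) /\
    forall e, e \in D -> q (edge_end e false) = q (edge_end e true) * s e.
Proof.
move=> noc P1 PM PV Ps; have [n] := ubnP #|D|; elim: n D noc => // n IHn D noc ltDn.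
have [-> | [e eD]] := finset.set_0Vmem D.
  by exists (fun=> 1); split=> // e; rewrite finset.inE.
set D' := D :\ e; have eD' : e \notin D' by rewrite finset.setD11.
have sub : D' \subset D by apply: finset.subD1set.
have [q [Pq qs]] : exists q : V -> H, (forall v, P (q v)) /\
    forall e, e \in D' -> q (edge_end e false) = q (edge_end e true) * s e.
  apply: IHn => [c|]; first by apply: contra (noc c); apply: circuitS.
  by rewrite -ltnS (leq_trans _ ltDn) // ltnS [X in (_ < X)%N](cardsD1 e) eD.
set u := edge_end e true in qs *; set w := edge_end e false in qs *.
have ncuw : ~~ connect (adjacent D') u w.
  apply/negP => /(circuit_close eD')[c]; rewrite finset.setD1K //.
  by apply/negP/noc.
exists (fun x => if connect (adjacent D') w x then q u * s e / q w * q x else q x).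
split=> [v | e'].
  case: ifP => // _.
  exact: (PM _ _ (PM _ _ (PM _ _ (Pq u) (Ps e)) (PV _ (Pq w))) (Pq v)).
rewrite -(finset.setD1K eD) finset.in_setU1 => /predU1P[-> | e'D].
  rewrite connect0 -/u -/w mulgVK.
  by rewrite connect_adjacent_sym (negbTE ncuw).
have adj := @adjacent_dart D' (e', true) e'D.
rewrite (same_connect_r (@connect_adjacent_sym D') (connect1 adj)).
by case: ifP => _; rewrite qs // mulgA.
Qed.

(** If a vertex is missing, some dart [d] leaves the tree. Adding it creates no circuit, because
    [d.1] is the only edge of the larger graph at [tgt d], and this contradicts maximality. *)
Lemma maximal_subtree_spanning (VT : {set V}) (ET : {set E}) :
  connected_graph Gam -> maximal_subtree VT ET ->
  forall v w, connect (adjacent ET) v w.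
Proof.
move=> [_ conG] [[subT [[u uT] conT] noc] maxT].
suff allT v : v \in VT by move=> v w; apply: conT.
apply/idPn => vT.
have [d [srcT tgtT]] : exists d, src d \in VT /\ tgt d \notin VT.
  apply: contrapT => nod; have /closed_connect clo : closed (adjacent [set: E]) VT.
    apply: (intro_closed (@connect_adjacent_sym _)) => x y /adjacentP[d [_ <- <-]] dT.
    by apply: contrapT => /negP tT; apply: nod; exists d.
  by have := clo _ _ (conG u v (finset.in_setT _) (finset.in_setT _)); rewrite uT (negbTE vT).
set A := tgt d |: VT; set D := d.1 |: ET.
have [] // := maxT A D; last first.
- by move=> eqA; move: tgtT; rewrite -eqA finset.setU11.
- exact: finset.subsetUr.
- exact: finset.subsetUr.
have endD e b : e \in ET -> edge_end e b \in VT by apply: subT.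
have tgt_rdart x : tgt (rdart x) = src x by rewrite /tgt /= negbK.
have dartE (x y : E * bool) : x.1 = y.1 -> x = y \/ x = rdart y.
  by case: x y => e [] [e' []] /= ->; auto.
split=> [e b | | c].
- rewrite !finset.in_setU1 => /predU1P[-> | /endD->]; last by rewrite orbT.
  rewrite -[edge_end d.1 b]/(src (d.1, b)).
  by have [-> | ->] := dartE (d.1, b) d erefl; rewrite ?srcT ?orbT ?eqxx.
- have up : forall x, x \in A -> connect (adjacent D) u x.
    have upT x : x \in VT -> connect (adjacent D) u x.
      move=> xT; apply: connect_sub (conT u x uT xT) => y z.
      case/adjacentP=> d' [d'T <- <-]; apply: connect1; apply: adjacent_dart.
      exact: finset.setU1r.
    move=> x /finset.setU1P[-> | /upT //]; apply: connect_trans (upT _ srcT) _.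
    by apply: connect1; apply: adjacent_dart; apply: finset.setU11.
  split=> [|x y xA yA]; first by exists u; apply: finset.setU1r.
  by apply: connect_trans (up y yA); rewrite connect_adjacent_sym up.
apply/negP => /and4P[c0 cD cyc uc].
have edge_d x : x \in c -> src x = tgt d \/ tgt x = tgt d -> x = d \/ x = rdart d.
  move=> /(allP cD)/finset.setU1P[/dartE // | xT] e; case/negP: tgtT.
  by case: e => <-; apply: endD.
have src_d : src d != tgt d by apply: contraNneq tgtT => e; rewrite -e.
(* The dart after [d] starts at [tgt d], so it is [d], which would be a loop, or [rdart d], which
   backtracks. *)
have d_notin : d \notin c.
  apply/negP => dc; have /andP[/eqP sn] := next_cycle cyc dc.
  have [] := edge_d (next c d); rewrite ?mem_next //; first by left.
    by move=> nd; case/eqP: src_d; rewrite -{1}nd; apply: esym sn.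
  by move=> ->; rewrite eqxx.
have rd_notin : rdart d \notin c.
  apply/negP => dc; have /andP[/eqP sn] := prev_cycle cyc dc.
  have := edge_d (prev c (rdart d)); rewrite mem_prev dc => /(_ isT) [].
  - by right; apply: sn.
  - by move=> dE; move: d_notin; rewrite -dE mem_prev dc.
  move=> dE; case/negP: src_d; rewrite -tgt_rdart.
  by rewrite -{1}dE; apply/eqP/sn.
have : circuit ET c.
  apply/and4P; split=> //; apply/allP => x xc.
  have /finset.setU1P[/dartE[] xd | //] := allP cD x xc.
    by rewrite -xd xc in d_notin.
  by rewrite -xd xc in rd_notin.
by apply/negP/noc.
Qed.

End Forests.

(** * The GBS-group *)

Lemma word_class_value (X : choiceType) (R : word X -> word X -> Prop) (w : word X) :
  word_class R w = word_value (pres_gen R) w.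
Proof.
elim: w => [|[x b] w IHw]; first by rewrite /word_value big_nil.
rewrite -cat1s word_value_cat -IHw -[LHS](pres_mulE R [:: (x, b)] w).
congr (_ * _); rewrite word_value_gen; case: b => //=.
by rewrite -[_^-1]/(pres_inv _) /pres_gen pres_invE.
Qed.

Section PathValues.
Context (Gam : multigraph) (L : labeling Gam).
Local Notation V := (vertex Gam).
Local Notation E := (edge Gam).
Context (H : groupType) (a : V -> H) (s : E -> H).

Lemma path_val_hom (K : groupType) (f : {multiplicative H -> K}) v l k :
  f (path_val a s v l k) = path_val (f \o a) (f \o s) v l k.
Proof.
elim: l v => [|[k' d] l IHl] v /=; first exact: gmulfz.
rewrite !gmulfM IHl gmulfz; congr (_ * (_ * _)).
by rewrite /dart_val; case: d.2 => //=; rewrite multfV.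
Qed.

(** A change of base points: the factors [q] cancel at every inner vertex of the path. *)
Lemma path_val_twist (q : V -> H) v l k w : is_path v l w ->
  path_val (fun x => a x ^ (q x)^-1)
    (fun e => q (edge_end e true) * s e / q (edge_end e false)) v l k =
  q v * path_val a s v l k / q w.
Proof.
elim: l v => [|[k' d] l IHl] v /= => [/eqP-> | /andP[/eqP <- /IHl->]].
  by rewrite -expgzJ conjgE invgK mulgA.
rewrite -expgzJ conjgE invgK /dart_val /src /tgt; case: d => e [] /=.
  by rewrite !mulgA !mulgVK.
by rewrite !invgM invgK !mulgA !mulgVK.
Qed.

Lemma is_rep_twist (q : V -> H) : is_rep L a s ->
  is_rep L (fun x => a x ^ (q x)^-1)
    (fun e => q (edge_end e true) * s e / q (edge_end e false)).
Proof.
move=> rep_s e /=; rewrite -!expgzJ !conjgM -[X in X ^ s e]conjgM mulVg conjg1.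
by rewrite rep_s.
Qed.

Definition reach v w (g : H) : Prop :=
  exists l k, is_path v l w /\ path_val a s v l k = g.

Lemma reach_pow v k : reach v v (expgz (a v) k).
Proof. by exists [::], k; rewrite /= eqxx. Qed.

Lemma reach1 v : reach v v 1.
Proof. exact: (reach_pow v 0). Qed.

Lemma reach_dart d : reach (src d) (tgt d) (dart_val s d).
Proof. by exists [:: (0%R, d)], 0%R; rewrite /= !eqxx !expg0 mul1g mulg1. Qed.

Lemma reachM u v w g h : reach u v g -> reach v w h -> reach u w (g * h).
Proof.
case=> l [k [uv <-]] [l' [k' [vw <-]]] {g h}.
elim: l u uv => [|[k1 d] l IHl] u /= => [/eqP-> | /andP[/eqP <- /IHl]].
  case: l' vw => [|[k2 d] l'] /= => [/eqP-> | /andP[/eqP <- vw]].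
    by exists [::], (k + k')%R; rewrite /= eqxx expgzD.
  by exists (((k + k2)%R, d) :: l'), k'; rewrite /= eqxx expgzD -mulgA.
case=> l2 [k2 [dw eq2]]; exists ((k1, d) :: l2), k2.
by rewrite /= eqxx dw eq2 !mulgA.
Qed.

End PathValues.

Section GBSGroup.
Context (Gam : multigraph) (L : labeling Gam).
Context (VT : {set vertex Gam}) (ET : {set edge Gam}).
Hypotheses (conG : connected_graph Gam) (maxT : maximal_subtree VT ET).
Local Notation V := (vertex Gam).
Local Notation E := (edge Gam).
Local Notation G := (gbs_group L ET).

Definition gv (v : V) : G := pres_gen (@gbs_rel _ L ET) (inl v).
(** Extended by 1 to the tree edges, so that all edges satisfy the same relation [is_rep]. *)
Definition te (e : E) : G :=
  if insub e is Some e' then pres_gen (@gbs_rel _ L ET) (inr e') else 1.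

Lemma te_tree e : e \in ET -> te e = 1.
Proof. by move=> eT; rewrite /te insubN // negbK. Qed.

Lemma te_stable (e : {e : E | e \notin ET}) :
  te (val e) = pres_gen (@gbs_rel _ L ET) (inr e).
Proof. by rewrite /te valK. Qed.

Lemma gbs_is_rep : is_rep L gv te.
Proof.
move=> e; have val_pow b : word_value (pres_gen (@gbs_rel _ L ET)) (vertex_pow L ET e b)
    = expgz (gv (edge_end e b)) (L e b) by rewrite word_value_pow.
have rel u v : gbs_rel L u v -> word_value (pres_gen (@gbs_rel _ L ET)) u =
                              word_value (pres_gen (@gbs_rel _ L ET)) v.
  by move=> /word_eq_rel uv; rewrite -!word_class_value; apply/word_classP.
case: (boolP (e \in ET)) => eT.
  by rewrite te_tree // conjg1 -!val_pow; apply: rel; apply: gbs_rel_tree.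
rewrite -[e]/(val (exist (fun e => e \notin ET) e eT)) te_stable.
have := rel _ _ (gbs_rel_stable L (exist (fun e => e \notin ET) e eT)).
by rewrite !word_value_cat !val_pow /= !word_value_gen.
Qed.

Lemma gbs_hom (H : groupType) (a : V -> H) (s : E -> H) :
  is_rep L a s -> (forall e, e \in ET -> s e = 1) ->
  exists f : {multiplicative G -> H},
    (forall v, f (gv v) = a v) /\ forall e, f (te e) = s e.
Proof.
move=> rep_s sT.
pose h (x : gbs_gen ET) : H := match x with inl v => a v | inr e => s (val e) end.
have [|f fE] := @presented_hom _ (@gbs_rel _ L ET) H h.
  move=> u v [e eT | e].
    by rewrite !word_value_pow /= -rep_s sT // conjg1.
  by rewrite !word_value_cat !word_value_pow !word_value_gen /= -rep_s.
exists f; split=> [v | e]; first by rewrite fE.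
rewrite /te; case: insubP => [e' _ <- | ]; first by rewrite fE.
by rewrite negbK => eT; rewrite sT // multf1.
Qed.

(** A representation may be non-trivial on tree edges. Twisting by a potential of the tree makes it
    trivial there, hence a homomorphism of [G], and conjugates the values of closed paths. *)
Lemma gbs_hom_path (H : groupType) (a : V -> H) (s : E -> H) : is_rep L a s ->
  exists (f : {multiplicative G -> H}) (q : V -> H), forall v l k w,
    is_path v l w -> f (path_val gv te v l k) = q v * path_val a s v l k / q w.
Proof.
move=> rep_s; have [[_ _ noc] _] := maxT.
have [q [_ qs]] := @forest_potential _ ET H s (fun=> True) noc
  Logic.I (fun _ _ _ _ => Logic.I) (fun _ _ => Logic.I) (fun _ => Logic.I).
have [e eT|f [fv fs]] := gbs_hom (is_rep_twist q rep_s).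
  by rewrite qs // mulgV.
exists f, q => v l k w vw; rewrite path_val_hom -path_val_twist //.
by congr path_val; apply/funext => x /=.
Qed.

Lemma path_val_detect (H : groupType) (a : V -> H) (s : E -> H) v l k :
  is_rep L a s -> is_path v l v -> path_val a s v l k <> 1 ->
  exists f : {multiplicative G -> H}, f (path_val gv te v l k) <> 1.
Proof.
move=> /gbs_hom_path[f [q fE]] vv nz; exists f; rewrite (fE _ _ _ _ vv) => eq1.
apply: nz; move: eq1 => /(congr1 (fun x => (q v)^-1 * (x * q v))).
by rewrite mul1g mulVg mulgVK mulKg.
Qed.

Lemma reach_tree v w : reach gv te v w 1.
Proof.
have /connectP[p] := maximal_subtree_spanning conG maxT v w.
elim: p v => [|u p IHp] v /=; first by move=> _ ->; apply: reach1.
case/andP=> /adjacentP[d [dT <- <-]] pp lp.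
rewrite -[1]mulg1; apply: reachM (IHp _ pp lp).
have -> : 1 = dart_val te d; last exact: reach_dart.
by rewrite /dart_val te_tree //; case: d.2; rewrite /= ?invg1.
Qed.

(** Tree paths have value 1, so a path between any two vertices can be closed up at [v] without
    changing its value. *)
Lemma reach_all v g : reach gv te v v g.
Proof.
have via u w h : reach gv te u w h -> reach gv te v v h.
  move=> uw; rewrite -[h]mul1g -[_ * h]mulg1.
  exact: reachM (reachM (reach_tree v u) uw) (reach_tree w v).
have dvia d : reach gv te v v (dart_val te d) := via _ _ _ (reach_dart _ _ d).
move: g; apply: presented_ind => [|g h vg vh|[u|e]|[u|e]].
- exact: reach1.
- exact: reachM vg vh.
- by apply: (via u u); rewrite -[pres_gen _ _]/(expgz (gv u) 1); apply: reach_pow.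
- by rewrite -te_stable; apply: (dvia (val e, true)).
- by apply: (via u u); rewrite -[pres_gen _ _]/(gv u) -expgzN1; apply: reach_pow.
- by rewrite -te_stable; apply: (dvia (val e, false)).
Qed.

End GBSGroup.

(** * Affine action and modular homomorphism *)

Definition rat_unit : Type := {x : rat | x != 0%R}.
HB.instance Definition _ := SubChoice.on rat_unit.

Section RatUnits.
Implicit Types x y : rat_unit.

Definition ru_one : rat_unit := exist _ 1%R (oner_neq0 _).
Definition ru_mul x y : rat_unit := exist _ (val x * val y)%R (mulf_neq0 (valP x) (valP y)).
Definition ru_inv x : rat_unit := exist _ (val x)^-1%R (invr_neq0 (valP x)).

Fact ru_mulA : associative ru_mul.
Proof. by move=> x y z; apply: val_inj; rewrite /= mulrA. Qed.
Fact ru_mul1 : left_id ru_one ru_mul.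
Proof. by move=> x; apply: val_inj; rewrite /= mul1r. Qed.
Fact ru_mulr1 : right_id ru_one ru_mul.
Proof. by move=> x; apply: val_inj; rewrite /= mulr1. Qed.
Fact ru_mulV : left_inverse ru_one ru_inv ru_mul.
Proof. by move=> x; apply: val_inj; rewrite /= mulVf ?(valP x). Qed.
Fact ru_mulrV : right_inverse ru_one ru_inv ru_mul.
Proof. by move=> x; apply: val_inj; rewrite /= mulfV ?(valP x). Qed.

HB.instance Definition _ := isGroup.Build rat_unit
  ru_mulA ru_mul1 ru_mulr1 ru_mulV ru_mulrV.

Definition rat_scale x (y : Algebra.to_multiplicative rat) : Algebra.to_multiplicative rat :=
  (val x * y)%R.

Fact rat_scaleM x : {morph rat_scale x : y z / y * z}.
Proof. by move=> y z; apply: mulrDr. Qed.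
Fact rat_scale1 (y : Algebra.to_multiplicative rat) : rat_scale 1 y = y.
Proof. exact: mul1r. Qed.
Fact rat_scaleA x y (z : Algebra.to_multiplicative rat) :
  rat_scale (x * y) z = rat_scale x (rat_scale y z).
Proof. by rewrite /rat_scale mulrA. Qed.

Definition rat_action := AutAction rat_scaleM rat_scale1 rat_scaleA.

End RatUnits.

Notation affine := (semidirect rat_action).
Definition transl (x : rat) : affine := sdl rat_action x.

Lemma transl_z x k : expgz (transl x) k = transl (x *~ k).
Proof.
by rewrite sdlz; case: k.
Qed.

Lemma transl_inj : injective transl.
Proof. by move=> x y []. Qed.

Lemma translJ x (g : affine) : transl x ^ g = transl (x / val g.2)%R.
Proof.
rewrite conjgE sdM sdV; congr pair; last by rewrite /= mul1g mulVg.
have conj_add (b : rat) : (- b + (x + b))%R = x by rewrite addrCA addNr addr0.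
rewrite /= rat_scale1 -rat_scaleM -[x in RHS](conj_add g.1) mulrC.
by [].
Qed.

Section ModularHomomorphism.
Context (Gam : multigraph) (L : labeling Gam).
Context (VT : {set vertex Gam}) (ET : {set edge Gam}).
Hypotheses (conG : connected_graph Gam) (maxT : maximal_subtree VT ET).
Local Notation V := (vertex Gam).
Local Notation E := (edge Gam).
Local Notation G := (gbs_group L ET).
Local Notation gv := (gv L ET).
Local Notation te := (te L ET).
Local Notation modular := (modular (L := L) (T := ET)).

Definition labelQ (e : E) (b : bool) : rat := (L e b)%:~R.

Lemma labelQ_neq0 e b : labelQ e b != 0%R.
Proof. by rewrite intr_eq0 label_neq0. Qed.

(* In an action of the GBS-group on the rational line where the stable letters
   of the tree edges are trivial, [r v] is the length by which [g_v] translates. *)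
Definition potential (r : V -> rat) : Prop :=
  (forall v, r v != 0%R) /\ forall e, e \in ET ->
    (labelQ e true * r (edge_end e true) = labelQ e false * r (edge_end e false))%R.

(** The tree relations prescribe the ratios of [r] along edges, and a forest admits a potential for
    any ratios. [P] allows the values to be kept among quotients of [rho]-numbers. *)
Lemma potential_exists (P : rat -> Prop) :
  P 1%R -> (forall x y, P x -> P y -> P (x * y)%R) -> (forall x, P x -> P x^-1%R) ->
  (forall e b, P (labelQ e b)) ->
  exists2 r, potential r & forall v, P (r v).
Proof.
move=> P1 PM PV Plab; have [[_ _ noc] _] := maxT.
pose s e : rat_unit := exist _ (labelQ e true / labelQ e false)%R
  (mulf_neq0 (labelQ_neq0 _ _) (invr_neq0 (labelQ_neq0 _ _))).
have [||||q [Pq qs]] := @forest_potential _ ET rat_unit s (P \o val) noc.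
- exact: P1.
- by move=> x y; apply: PM.
- by move=> x; apply: PV.
- by move=> e; apply: PM; last exact: PV.
exists (val \o q) => //; split=> [v | e eT] /=; first exact: (valP (q v)).
rewrite qs //= [RHS]mulrCA mulrC; congr (_ * _)%R.
by rewrite mulrC divfK ?labelQ_neq0.
Qed.

Section Potential.
Context (r : V -> rat).
Hypothesis r_pot : potential r.

(** The scaling forced on the stable letter by the edge relation between translations; it is 1 on
    tree edges. *)
Definition dilation (e : E) : rat :=
  ((labelQ e true * r (edge_end e true)) / (labelQ e false * r (edge_end e false)))%R.

Lemma dilation_neq0 e : dilation e != 0%R.
Proof.
by case: r_pot => r0 _; rewrite !mulf_neq0 ?invr_neq0 ?mulf_neq0 ?labelQ_neq0.
Qed.

Definition aff_stable (e : E) : affine :=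
  sdr rat_action (exist _ (dilation e) (dilation_neq0 e)).

Lemma affine_is_rep : is_rep L (transl \o r) aff_stable.
Proof.
case: r_pot => r0 _ e; rewrite /= !transl_z translJ /=; congr transl.
rewrite -[RHS]mulrzl -mulrzl -/(labelQ e true) -/(labelQ e false) /dilation invf_div mulrC.
by rewrite divfK // mulf_neq0 ?labelQ_neq0.
Qed.

Lemma affine_faithful d k j :
  expgz ((transl \o r) (src d)) k = expgz ((transl \o r) (src d)) (lam L d * j) ->
  (lam L d %| k)%Z.
Proof.
case: r_pot => r0 _; rewrite /= !transl_z => /transl_inj.
rewrite -[LHS]mulrzl -[RHS]mulrzl => /(mulIf (r0 _))/eqP; rewrite eqr_int => /eqP->.
exact: dvdz_mulr.
Qed.

Lemma affine_hom : exists f : {multiplicative G -> affine},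
  (forall v, f (gv v) = transl (r v)) /\ forall e, f (te e) = aff_stable e.
Proof.
apply: gbs_hom affine_is_rep _ => e eT; congr pair; apply: val_inj => /=.
case: r_pot => r0 rT; rewrite /dilation rT // divff //.
by rewrite mulf_neq0 ?labelQ_neq0.
Qed.

End Potential.

(** Britton's lemma for closed paths, by separation over the affine representation; the class
    supplies the groups that detect free words. *)
Lemma reduced_path_neq1 (C : group_class) p l v k :
  root_class C -> class_primes C p ->
  is_path v l v -> reduced_path L l -> l <> [::] -> path_val gv te v l k <> 1.
Proof.
move=> rootC Cp vv red_l l0.
have [] // := @potential_exists (fun=> True); move=> r r_pot _.
have [U [t [_ rep_t nz]]] :=
  path_separation rootC Cp (affine_is_rep r_pot) (affine_faithful r_pot) k vv red_l l0.
have [f f1] := path_val_detect maxT rep_t vv nz.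
by move=> eq1; apply: f1; rewrite eq1 multf1.
Qed.

(** Induction along a path: multiplying the exponent by [lam d] lets the power pass across the dart
    [d]. *)
Lemma commensurable g v : exists m n : int, [/\ m != 0%R, n != 0%R &
  expgz (gv v) m ^ g = expgz (gv v) n].
Proof.
have [l [k [vv <-]]] := reach_all conG maxT v g.
suff gen u w : is_path u l w -> exists m n : int, [/\ m != 0%R, n != 0%R &
    expgz (gv u) m ^ path_val gv te u l k = expgz (gv w) n] by apply: gen.
elim: l u {vv} => [|[k' d] l IHl] u /= => [/eqP-> | /andP[/eqP <- /IHl]].
  by exists 1%R, 1%R; split=> //; rewrite conjgE commute_expgz ?mulKg.
case=> m [n [m0 n0 eq]]; exists (lam L d * m)%R, (lam L (rdart d) * n)%R.
rewrite !mulf_neq0 ?label_neq0 //; split=> //.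
rewrite !conjgM expgz_conj [expgz _ (lam L d * m)]expgzM.
rewrite expgzJ (rep_dart (gbs_is_rep L ET)) expgzMC expgzJ eq.
by rewrite mulrC expgzM.
Qed.

Lemma gv_order v k : expgz (gv v) k = 1 -> k = 0%R.
Proof.
have [] // := @potential_exists (fun=> True); move=> r r_pot _.
have [f [fv _]] := affine_hom r_pot.
move=> /(congr1 f); rewrite gmulfz fv multf1 transl_z -[1]/(transl 0) => /transl_inj.
case: r_pot => r0 _; rewrite -mulrzl => /eqP; rewrite mulf_eq0 (negbTE (r0 v)) orbF.
by rewrite intr_eq0 => /eqP.
Qed.

(** Non-trivial elliptic elements act by non-zero translations, which conjugation by [g] divides by
    its dilation part, so all admissible quotients [n / m] agree. By [commensurable] one exists,
    which excludes the default value of [xget]. *)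
Lemma modularE (r : V -> rat) (f : {multiplicative G -> affine}) :
  (forall v, r v != 0%R) -> (forall v, f (gv v) = transl (r v)) ->
  forall g, modular g = (val (f g).2)^-1%R.
Proof.
move=> r0 fv g; have [[v _] _] := conG.
have ell_transl (a : G) : elliptic a -> a <> 1 -> exists2 x, x != 0%R & f a = transl x.
  case=> w [h [_ [[k _ <-] ->]]] a1.
  exists ((r w *~ k) / val (f h).2)%R; last by rewrite multfJ gmulfz fv transl_z translJ.
  rewrite mulf_neq0 ?invr_neq0 ?(valP (f h).2) // -mulrzl mulf_neq0 // intr_eq0.
  by apply: contra_not_neq a1 => ->; rewrite conj1g.
have uniq q : (exists (a : G) (m n : int), [/\ elliptic a /\ a <> 1, m != 0%R /\ n != 0%R,
    expgz a m ^ g = expgz a n & q = (n%:~R / m%:~R)%R]) -> q = (val (f g).2)^-1%R.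
  case=> a [m [n [[ell_a a1] [m0 n0] eqa ->]]].
  have [x x0 fa] := ell_transl a ell_a a1.
  move/(congr1 f): eqa; rewrite multfJ !gmulfz fa !transl_z translJ => /transl_inj.
  rewrite -mulrzl -[RHS]mulrzl mulrAC => /(mulIf x0) <-.
  by rewrite mulrAC divff ?mul1r // intr_eq0.
rewrite /modular; case: xgetP => [q _ /uniq // | none].
have [m [n [m0 n0 eqg]]] := commensurable g v.
case: (none (n%:~R / m%:~R)%R); exists (gv v), m, n; split=> //; split.
  by exists v, 1, (gv v); rewrite conjg1; split=> //; exists 1%R.
by move=> gv1; have /eqP := @gv_order v 1 gv1; rewrite oner_eq0.
Qed.

End ModularHomomorphism.

(** * Sufficient conditions *)

Section ResidualCriterion.
Context (Gam : multigraph) (L : labeling Gam).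
Context (VT : {set vertex Gam}) (ET : {set edge Gam}).
Hypotheses (conG : connected_graph Gam) (maxT : maximal_subtree VT ET).
Context (C : group_class) (p : nat).
Hypotheses (rootC : root_class C) (Cp : class_primes C p).
Local Notation V := (vertex Gam).
Local Notation E := (edge Gam).
Local Notation G := (gbs_group L ET).
Local Notation gv := (gv L ET).
Local Notation te := (te L ET).
Local Notation modular := (modular (L := L) (T := ET)).
Local Notation rho := (class_primes C).

(** A reduced closed path is either empty, and its value is detected by [A] itself, or non-empty,
    and detected in a wreath product over [A]. *)
Lemma residual_criterion :
  (forall v k, k != 0%R -> exists (A : groupType) (a : V -> A) (s : E -> A),
    [/\ C A, is_rep L a s, expgz (a v) k <> 1 & forall d i j,
      expgz (a (src d)) i = expgz (a (src d)) (lam L d * j) -> (lam L d %| i)%Z]) ->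
  residually C G.
Proof.
move=> data; apply: (residually_hom rootC) => g g1.
have [[v _] _] := conG.
have [l0 [k0 [vv0 eq0]]] := reach_all conG maxT v g.
have [l [k [vv red_l eq1]]] := reduce_path (gbs_is_rep L ET) k0 vv0.
rewrite -eq0 -eq1 in g1 *.
case: l vv red_l g1 {eq1} => [|x l] vv red_l g1.
  have k1 : k != 0%R by apply: contra_not_neq g1 => ->.
  have [A [a [s [CA rep_s nz _]]]] := data v k k1.
  have [f f1] := path_val_detect maxT (l := [::]) rep_s vv nz.
  by exists A, f.
have [A [a [s [CA rep_s _ faith]]]] := data v 1%R isT.
have [//|U [t [CU rep_t nz]]] := path_separation rootC Cp rep_s faith k vv red_l.
have [f f1] := path_val_detect maxT rep_t vv nz.
by exists (wreath U A), f; split=> //; apply: class_wreath.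
Qed.

Lemma rho_number1 : rho_number rho 1.
Proof. by move=> q q_pr; rewrite dvdn1 => /eqP q1; rewrite q1 in q_pr. Qed.

Lemma rho_numberM m n : rho_number rho m -> rho_number rho n -> rho_number rho (m * n)%R.
Proof.
by move=> rm rn q q_pr; rewrite abszM Euclid_dvdM // => /orP[/rm|/rn]; apply.
Qed.

Lemma rho_number_prod (I : finType) (P : pred I) (F : I -> int) :
  (forall i, rho_number rho (F i)) -> rho_number rho (\prod_(i | P i) F i)%R.
Proof.
by move=> rF; apply: big_ind => // [|m n]; [apply: rho_number1 | apply: rho_numberM].
Qed.

(** The values of [r] are taken as quotients of [rho]-numbers, and [D] is the product of their
    denominators. *)
Lemma integer_potential : (forall e b, rho_number rho (L e b)) ->
  exists (r : V -> rat) (D : rat) (R : V -> int),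
    [/\ potential L ET r, D != 0%R, forall v, (r v * D = (R v)%:~R)%R
      & forall v, rho_number rho (R v) /\ R v != 0%R].
Proof.
move=> rhoL.
pose good (x : rat) (nd : int * int) := [/\ rho_number rho nd.1, rho_number rho nd.2,
  nd.1 != 0%R, nd.2 != 0%R & x = (nd.1%:~R / nd.2%:~R)%R].
have [||||r r_pot good_r] := @potential_exists _ L VT ET maxT (fun x => exists nd, good x nd).
- by exists (1%R, 1%R); split=> //; apply: rho_number1.
- move=> x y [[n d] [/= rn rd n0 d0 ->]] [[n' d'] [/= rn' rd' n0' d0' ->]].
  exists (n * n', d * d')%R; split; rewrite /= ?mulf_neq0 //; try exact: rho_numberM.
  by rewrite !intrM mulf_div.
- move=> x [[n d] [/= rn rd n0 d0 ->]]; exists (d, n); split=> //=.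
  by rewrite invf_div.
- move=> e b; exists (L e b, 1%R); split; rewrite ?label_neq0 ?divr1 //=.
  exact: rho_number1.
have [nd ndE] := choice good_r.
exists r, (\prod_w (nd w).2%:~R)%R, (fun v => (nd v).1 * \prod_(w | w != v) (nd w).2)%R.
split=> // [||v].
- by apply/prodf_neq0 => v _; have [_ _ _] := ndE v; rewrite intr_eq0.
- move=> v; have [_ _ _ d0 ->] := ndE v.
  rewrite (bigD1 v) //= mulrA divfK ?intr_eq0 // intrM; congr (_ * _)%R.
  by rewrite rmorph_prod.
have [rn rd n0 d0 _] := ndE v; split.
  by apply: rho_numberM => //; apply: rho_number_prod => w; have [] := ndE w.
by rewrite mulf_neq0 //; apply/prodf_neq0 => w _; have [] := ndE w.
Qed.

(* [sg e] is the sign of the modular homomorphism on the edge [e], realized in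
   [A] by the action of [t e] on [z]. *)
Lemma residual_of_signs (sg : E -> int) :
  (forall e b, rho_number rho (L e b)) ->
  (forall e, modular (te e) = (sg e)%:~R%R) -> (forall e, (sg e * sg e)%R = 1%R) ->
  (forall N, (0 < N)%N -> rho_number rho N ->
    exists (A : groupType) (z : A) (t : E -> A),
      [/\ C A, has_order z N & forall e, z ^ t e = expgz z (sg e)]) ->
  residually C G.
Proof.
move=> rhoL modL sg2 data; apply: residual_criterion => v k k0.
have [r [D [R [r_pot D0 rD RP]]]] := integer_potential rhoL.
have R0 w : R w != 0%R by have [] := RP w.
(* The dilation of [e] equals the sign [sg e], so the integers [R] satisfy the edge relations up to
   that sign. *)
have LR e : (L e true * R (edge_end e true))%R =
            (sg e * (L e false * R (edge_end e false)))%R.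
  have [f [fv fs]] := affine_hom r_pot.
  have := modL e; rewrite (modularE conG maxT (proj1 r_pot) fv) fs /= invf_div => dil.
  apply/eqP; rewrite -(eqr_int rat) !intrM -!rD; apply/eqP.
  have e1 : (labelQ L e false * r (edge_end e false) =
             (sg e)%:~R * (labelQ L e true * r (edge_end e true)))%R.
    by rewrite -dil divfK // mulf_neq0 ?labelQ_neq0 //; apply: (proj1 r_pot).
  by rewrite [X in _ = (_ * X)%R]mulrA e1 !mulrA -intrM sg2 mul1r.
pose M := (\prod_(x : E * bool) L x.1 x.2 * \prod_w R w)%R.
(* The power of [p] exceeds the absolute value of [R v * k], so [z] to that exponent is not 1. The
   factor [M] makes [N] a multiple of each [R (src d) * lam d], which yields faithfulness. *)
pose N := (p ^ `|(R v * k)%R| * `|M|)%N.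
have p_pr : prime p by case: Cp.
have M0 : M != 0%R.
  by rewrite mulf_neq0 //; apply/prodf_neq0 => x _; rewrite ?label_neq0.
have N_gt0 : (0 < N)%N by rewrite muln_gt0 expn_gt0 prime_gt0 // absz_gt0.
have rhoN : rho_number rho N.
  move=> q q_pr; rewrite /= Euclid_dvdM // => /orP[|].
    by rewrite Euclid_dvdX // dvdn_prime2 // => /andP[/eqP-> _].
  apply: rho_numberM q_pr; apply: rho_number_prod => // w.
  by have [] := RP w.
have [A [z [t [CA oz zt]]]] := data N N_gt0 rhoN.
exists A, (fun w => expgz z (R w)), t; split=> // [e | | d i j] /=.
- rewrite -!expgzM [(R _ * L _ _)%R]mulrC LR expgzJ zt -expgzM mulrA sg2 mul1r.
  by rewrite mulrC.
- rewrite -expgzM oz dvdzE /= => /dvdn_leq; rewrite absz_gt0 mulf_neq0 // => /(_ isT).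
  rewrite leqNgt => /negP; apply; apply: leq_trans (ltn_expl _ (prime_gt1 p_pr)) _.
  by rewrite leq_pmulr // absz_gt0.
rewrite -!expgzM => eqz.
have : expgz z (R (src d) * (i - lam L d * j))%R = 1.
  by rewrite mulrBr expgzD expgzN eqz mulgV.
move/oz => dvdN; rewrite -[i](subrK (lam L d * j)%R).
apply: rpredD; last exact: dvdz_mulr.
rewrite -[_ \in _]/(lam L d %| (i - lam L d * j)%R)%Z -(@dvdz_mul2l (R (src d))) ?R0 //.
apply: dvdz_trans dvdN; rewrite dvdzE /=; apply: dvdn_mull.
rewrite /M (bigD1 d) //= (bigD1 (src d)) //= -dvdzE.
by rewrite mulrC; apply: dvdz_mul; apply: dvdz_mulr.
Qed.

End ResidualCriterion.

Section CyclicGroups.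
From mathcomp Require Import all_fingroup all_solvable.
Context (C : group_class).
Hypothesis rootC : root_class C.

Lemma Zp1_order n : has_order (inZp 1 : 'I_n.+1) n.+1.
Proof.
apply: element_has_order; split=> // [|k /andP[k_gt0 ltkn]].
  by apply: val_inj; rewrite -[LHS]/(val (inZp 1 ^+ n.+1)) Zp_expg /= modnMml mul1n modnn.
move=> /(congr1 val); rewrite -[LHS]/(val (inZp 1 ^+ k)) Zp_expg /= modnMml mul1n.
by rewrite modn_small // => k0; rewrite k0 in k_gt0.
Qed.

Lemma class_cyclic n : rho_number (class_primes C) n.+1 -> C 'I_n.+1.
Proof.
move=> rhoN.
have setM : {morph (fun x : 'I_n.+1 => subg [set: 'I_n.+1] x) : x y / monoid.mul x y}.
  by move=> x y; apply: val_inj; rewrite /= !subgK ?finset.in_setT.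
apply: (class_inj rootC (f := mult_of setM)).
  by move=> x y /= /(congr1 sgval); rewrite !subgK ?finset.in_setT.
apply: (class_solvable_group rootC).
  by move=> p p_pr; rewrite cardsT card_ord; apply: rhoN.
by apply: abelian_sol; apply/centsP=> x _ y _; apply: Zp_mulgC.
Qed.

End CyclicGroups.

Section Dihedral.
Context (n : nat).
Local Notation Z := 'I_n.+1.

Definition flip (q : 'I_2) (x : Z) : Z := if q == 0%R then x else x^-1.

Fact flipM q : {morph flip q : x y / x * y}.
Proof. by move=> x y; rewrite /flip; case: ifP => // _; rewrite invgM; apply: Zp_mulgC. Qed.
Fact flip1 x : flip 1 x = x.
Proof. by []. Qed.
Fact flipA q r x : flip (q * r) x = flip q (flip r x).
Proof. by case: q r => [[|[|//]] ?] [[|[|//]] ?] //; rewrite /flip /= invgK. Qed.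

Definition dihedral := semidirect (AutAction flipM flip1 flipA).

End Dihedral.

Section SufficientConditions.
Context (Gam : multigraph) (L : labeling Gam).
Context (VT : {set vertex Gam}) (ET : {set edge Gam}).
Hypotheses (conG : connected_graph Gam) (maxT : maximal_subtree VT ET).
Context (C : group_class) (p : nat).
Hypotheses (rootC : root_class C) (Cp : class_primes C p).
Local Notation V := (vertex Gam).
Local Notation E := (edge Gam).
Local Notation G := (gbs_group L ET).
Local Notation te := (te L ET).
Local Notation modular := (modular (L := L) (T := ET)).
Local Notation rho := (class_primes C).
Hypothesis rhoL : forall e b, rho_number rho (L e b).

Lemma residually_positive : (forall e, modular (te e) = 1%R) -> residually C G.
Proof.
move=> mod1; apply: (residual_of_signs conG maxT rootC Cp (sg := fun=> 1%R)) => //.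
case=> // n _ rhoN; exists 'I_n.+1, (inZp 1), (fun=> 1); split.
- exact: class_cyclic.
- exact: Zp1_order.
- by move=> e; rewrite conjg1.
Qed.

(** Edges of modular value -1 act as a reflection of a dihedral group, the others trivially. *)
Lemma residually_signed : rho 2 ->
  (forall e, modular (te e) = 1%R \/ modular (te e) = (-1)%R) -> residually C G.
Proof.
move=> rho2 mod1; pose sg e : int := if modular (te e) == 1%R then 1%R else (-1)%R.
apply: (residual_of_signs conG maxT rootC Cp (sg := sg)) => // [e|e|].
- by rewrite /sg; have [->|->] := mod1 e.
- by rewrite /sg; case: ifP.
case=> // n _ rhoN; pose t e : 'I_2 := if modular (te e) == 1%R then 1 else inZp 1.
exists (dihedral n), (sdl _ (inZp 1)), (fun e => sdr _ (t e)); split.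
- apply: class_semidirect => //; apply: class_cyclic => //.
  by move=> q q_pr; rewrite dvdn_prime2 // => /eqP->.
- by move=> k; rewrite sdlz -(Zp1_order n); split=> [[]|->].
move=> e; rewrite sdlz /t /sg; case: ifP => _.
  by rewrite -[sdr _ _]/(1 : dihedral n) conjg1.
rewrite conjgE sdM sdV; congr pair; last by rewrite /= mul1g mulVg.
by rewrite /= flip1 mulg1 /flip /= !invg1 mul1g.
Qed.

End SufficientConditions.

(** * Necessary conditions *)

Lemma dart_val_rdart (Gam : multigraph) (H : groupType) (s : edge Gam -> H) d :
  dart_val s (rdart d) = (dart_val s d)^-1.
Proof. by case: d => e []; rewrite /dart_val //= invgK. Qed.

Lemma src_rdart (Gam : multigraph) d : src (@rdart Gam d) = tgt d.
Proof. by []. Qed.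

Lemma tgt_rdart (Gam : multigraph) d : tgt (@rdart Gam d) = src d.
Proof. by rewrite /tgt /= negbK. Qed.

(** * Solvability for a single loop with a unit label *)

Section SolvableCase.
Context (Gam : multigraph) (L : labeling Gam) (ET : {set edge Gam}).
Local Notation G := (gbs_group L ET).
Local Notation gv := (gv L ET).
Local Notation te := (te L ET).
Context (d : edge Gam * bool).
Hypotheses (one_vertex : forall v, v = src d) (one_edge : forall e, e = d.1).
Hypothesis unit_label : `|lam L (rdart d)|%N = 1%N.
Local Notation c := (gv (src d)).
Local Notation t := (dart_val te d).
Local Notation eps := (lam L (rdart d)).

Lemma unit_label_sqr : (eps * eps)%R = 1%R.
Proof. by move: unit_label; case: eps => [[|[|//]] | [|//]]. Qed.

(* The union of the ascending chain of the conjugates of [<c>] by powers of [t]. *)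
Definition base : set G := [set x | exists (i : nat) k, x = expgz c k ^ (t ^+ i)].

(** The loop relation solved for a power of [c], using [eps * eps = 1]; it makes the chain
    ascend. *)
Lemma base_step k : expgz c k = expgz c (lam L d * (eps * k)) ^ t.
Proof.
rewrite expgzM expgzJ (rep_dart (gbs_is_rep L ET)) -expgzM mulrA.
by rewrite (one_vertex (tgt d)) unit_label_sqr mul1r.
Qed.

Lemma base_raise i j k : exists k', expgz c k ^ (t ^+ i) = expgz c k' ^ (t ^+ (j + i)).
Proof.
elim: j => [|j [k' ->]]; first by exists k.
by exists (lam L d * (eps * k'))%R; rewrite {1}base_step -conjgM -expgS.
Qed.

Lemma base_common x y : base x -> base y ->
  exists i k l, x = expgz c k ^ (t ^+ i) /\ y = expgz c l ^ (t ^+ i).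
Proof.
case=> [i [k ->]] [j [l ->]].
have [k' ->] := base_raise i j k; have [l' ->] := base_raise j i l.
by exists (i + j)%N, k', l'; rewrite addnC.
Qed.

Lemma base_subgroup : is_subgroup base.
Proof.
split=> [|x y /base_common bx /bx[i [k [l [-> ->]]]]].
  by exists 0, 0%R; rewrite conj1g.
by exists i, (k - l)%R; rewrite expgzD expgzN conjMg conjVg.
Qed.

Lemma base_commute x y : base x -> base y -> commute x y.
Proof.
move=> /base_common bx /bx[i [k [l [-> ->]]]].
by rewrite /commute -!conjMg -!expgzD addrC.
Qed.

Lemma baseM x y : base x -> base y -> base (x * y).
Proof.
have [b1 bV] := base_subgroup; move=> bx bby.
by rewrite -[y]invgK; apply: (bV) => //; rewrite -div1g; apply: (bV).
Qed.

Lemma baseV x : base x -> base x^-1.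
Proof. by have [b1 bV] := base_subgroup; move=> bx; rewrite -div1g; apply: bV. Qed.

Lemma baseJ x k : base x -> base (x ^ expgz t k).
Proof.
have step y : base y -> base (y ^ t).
  by case=> i [l ->]; exists i.+1, l; rewrite -conjgM -expgSr.
have stepV y : base y -> base (y ^ t^-1).
  case=> i [l ->]; have [l' ->] := base_raise i 1 l.
  by exists i, l'; rewrite add1n expgSr conjgM conjgK.
have steps (u : G) n y : (forall z, base z -> base (z ^ u)) -> base y -> base (y ^ (u ^+ n)).
  move=> bu b_y; elim: n => [|n IHn]; first by rewrite conjg1.
  by rewrite expgSr conjgM; apply: bu.
case: k => n bx; first exact: steps.
by rewrite /= -expVgn; apply: steps.
Qed.

(** Powers of [t] normalize the base, so the products [b t^k] are closed under multiplication, and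
    they contain the generators and their inverses. *)
Lemma base_factor g : exists b k, base b /\ g = b * expgz t k.
Proof.
have base_c k : base (expgz c k) by exists 0, k; rewrite conjg1.
have t_pow k : exists b j, base b /\ expgz t k = b * expgz t j.
  by exists 1, k; rewrite mul1g; split=> //; apply: (base_c 0).
have te_pow k : exists j, expgz (te d.1) k = expgz t j.
  rewrite /dart_val; case: d.2 => /=; first by exists k.
  by exists (- k)%R; rewrite expgVz opprK.
move: g; apply: presented_ind => [|_ _ [b [j [bb ->]]] [b' [k [bb' ->]]]|[v|e]|[v|e]].
- exact: (t_pow 0).
- exists (b * b' ^ expgz t (- j)%R), (j + k)%R; split.
    by apply: baseM => //; apply: baseJ.
  by rewrite expgzD conjgE -expgzN opprK expgzN !mulgA mulgVK.
- exists c, 0%R; split; first exact: (base_c 1%R).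
  by rewrite mulg1 -(one_vertex v).
- by rewrite -te_stable (one_edge (val e)); have [j] := te_pow 1%R; rewrite expgz1 => ->.
- exists c^-1, 0%R; split; first by rewrite -expgzN1; apply: base_c.
  by rewrite mulg1 -(one_vertex v).
- by rewrite -te_stable (one_edge (val e)) -expgzN1; have [j ->] := te_pow (-1)%R.
Qed.

(** In [(h g)^-1 (g h)] both products carry the same power of [t], which only conjugates an element
    of the base. *)
Lemma base_commutator g h : base [~ g, h].
Proof.
have [b [j [bb ->]]] := base_factor g; have [b' [k [bb' ->]]] := base_factor h.
have prod_eq (x y : G) i l : (x * expgz t i) * (y * expgz t l) =
    (x * y ^ expgz t (- i)%R) * expgz t (i + l)%R.
  by rewrite expgzD conjgE -expgzN opprK expgzN !mulgA mulgVK.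
have -> (x y : G) : [~ x, y] = (y * x)^-1 * (x * y) by rewrite commgEl conjgE invgM !mulgA.
rewrite !prod_eq [(k + j)%R]addrC invgM -mulgA.
rewrite [X in _ * X]mulgA -conjgE; apply: baseJ.
by apply: baseM; [apply: baseV|]; apply: baseM => //; apply: baseJ.
Qed.

Lemma single_loop_solvable : is_solvable G.
Proof.
have der1 : derived 1 `<=` (base : set G).
  apply: smallest_sub; first exact: base_subgroup.
  by move=> _ [x _ [y _ <-]]; apply: base_commutator.
exists 2; apply: smallest_sub.
  by split=> // x y -> ->; rewrite /= mulgV.
move=> _ [x /der1 bx [y /der1 b_y <-]] /=.
by apply/eqP/commgP; apply: base_commute.
Qed.

End SolvableCase.

(** Let [n = q^a n'] with [n'] prime to [q]. The hypothesis gives that [q^a] divides [m1], and a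
    Bezout relation [u n' + v q = 1] gives [m1 - m v = m1 u n']. So, for [x] of order [n], [x^m1] is
    a power of [x^m]. *)
Lemma dvd_prime_defect (n q : nat) (m : int) : (0 < n)%N -> prime q ->
  m != 0%R -> ~~ (q ^ logn q `|m| %| n)%N -> forall m1, m = (m1 * q%:Z)%R ->
  exists j, (Posz n %| (m1 - m * j)%R)%Z.
Proof.
move=> n_gt0 q_pr m0 nd m1 def_m.
have [n' co_qn' def_n] := pfactor_coprime q_pr n_gt0.
have m_gt0 : (0 < `|m|)%N by rewrite absz_gt0.
have dvd1 : (q ^ logn q n %| `|m1|)%N.
  have m1_gt0 : (0 < `|m1|)%N.
    by rewrite absz_gt0; apply: contraNneq m0 => m10; rewrite def_m m10 mul0r.
  rewrite pfactor_dvdn // -ltnS.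
  have -> : (logn q `|m1|).+1 = logn q `|m|.
    by rewrite def_m abszM (lognM _ m1_gt0 (prime_gt0 q_pr)) [logn q q]logn_prime // eqxx addn1.
  by rewrite ltnNge -pfactor_dvdn.
have /coprimezP[[u v] /= uv] : coprimez n' q by rewrite coprimezE /= coprime_sym.
exists v; have -> : (m1 - m * v)%R = (m1 * (u * n'))%R.
  by rewrite def_m -mulrA -{1}[m1]mulr1 -mulrBr -uv [(q%:Z * v)%R]mulrC addrK.
rewrite {1}def_n PoszM [(Posz n' * _)%R]mulrC; apply: dvdz_mul; last exact: dvdz_mull.
by rewrite dvdzE; apply: dvd1.
Qed.

(** Division by [m] as long as possible. As [m] may be composite, [nu] is merely indivisible by [m],
    which is what prevents a pinch later. *)
Lemma coprime_prime_to_part (m n : int) : (1 < `|m|)%N -> n != 0%R ->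
  exists k nu, n = (m ^+ k * nu)%R /\ ~~ (m %| nu)%Z.
Proof.
move=> m_gt1; have [b] := ubnP `|n|; elim: b n => // b IHb n lenb n0.
have [/dvdzP[q def_n] | ] := boolP (m %| n)%Z; last by exists 0, n; rewrite mul1r.
have q0 : q != 0%R by apply: contraNneq n0 => q0; rewrite def_n q0 mul0r.
have [|k [nu [def_q nd]]] := IHb q _ q0.
  rewrite -ltnS; apply: leq_ltn_trans lenb; rewrite def_n abszM.
  by rewrite ltn_Pmulr // absz_gt0.
by exists k.+1, nu; split=> //; rewrite def_n def_q exprSr mulrAC.
Qed.

(** * Orders of the vertex generators in the quotients *)

Section Necessity.
Context (Gam : multigraph) (L : labeling Gam).
Context (VT : {set vertex Gam}) (ET : {set edge Gam}).
Hypotheses (conG : connected_graph Gam) (maxT : maximal_subtree VT ET).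
Context (C : group_class) (p : nat).
Hypotheses (rootC : root_class C) (Cp : class_primes C p).
Hypothesis perC : forall X : groupType, C X -> periodic X.
Local Notation V := (vertex Gam).
Local Notation E := (edge Gam).
Local Notation G := (gbs_group L ET).
Local Notation gv := (gv L ET).
Local Notation te := (te L ET).
Local Notation src := (@src Gam).
Local Notation tgt := (@tgt Gam).
Local Notation lam := (lam L).
Local Notation rep_G := (gbs_is_rep L ET).
Local Notation dv := (dart_val te).
Hypotheses (redL : reduced L) (not_sol : ~ is_solvable G) (resG : residually C G).
Implicit Types d : E * bool.

Lemma residually_eq (g h : G) :
  (forall (H : groupType) (f : {multiplicative G -> H}), C H -> f g = f h) -> g = h.
Proof.
move=> eq_f; apply: contrapT => gh.
have gh1 : g / h <> 1 by move/divg1_eq.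
by have [H [f [CH _]]] := resG gh1; apply; rewrite gmulfM multfV (eq_f _ f CH) mulgV.
Qed.

Lemma residually_commute (g h : G) :
  (forall (H : groupType) (f : {multiplicative G -> H}), C H -> commute (f g) (f h)) ->
  commute g h.
Proof.
move=> com_f; apply: residually_eq => H f CH.
by rewrite [LHS]gmulfM [RHS]gmulfM; apply: com_f.
Qed.

Lemma conj_root d : expgz (gv (tgt d) ^ (dv d)^-1) (lam (rdart d)) = expgz (gv (src d)) (lam d).
Proof. by rewrite -expgzJ -(rep_dart rep_G) conjgK. Qed.

Lemma unit_is_loop d : `|lam (rdart d)|%N = 1%N -> tgt d = src d.
Proof.
move=> /redL/eqP; rewrite /src /tgt; case: d => e [] /=; by move=> ->.
Qed.

(** Otherwise the loop is the whole connected graph and [single_loop_solvable] applies. *)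
Lemma other_edge d : `|lam (rdart d)|%N = 1%N ->
  exists d2, src d2 = src d /\ d2.1 != d.1.
Proof.
move=> unit_d; apply: contrapT => none; apply: not_sol.
have same d2 : src d2 = src d -> d2.1 = d.1.
  by move=> sd2; apply: contrapT => /eqP ne; apply: none; exists d2.
have loop := unit_is_loop unit_d.
have ends b : edge_end d.1 b = src d.
  by move: loop; rewrite /src /tgt; case: d {unit_d none same} => e []; case: b.
have one v : v = src d.
  have /closed_connect clo : closed (adjacent [set: E]) (pred1 (src d)).
    apply: intro_closed => [|x y /adjacentP[d2 [_ <- <-]]]; first exact: connect_adjacent_sym.
    by rewrite !inE => /eqP/same e2; rewrite /tgt e2 ends.
  have := clo _ _ (conG.2 (src d) v (finset.in_setT _) (finset.in_setT _)).
  by rewrite !inE eqxx => /esym/eqP.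
apply: (@single_loop_solvable _ L ET d) => // e.
exact: (same (e, true) (one _)).
Qed.

(** The commutator is the value of a closed path of length 4, reduced because [lam d] does not
    divide [k] and [lam (rdart d)] does not divide 1. *)
Lemma not_commute_tree d k : ~~ (lam d %| k)%Z -> `|lam (rdart d)|%N <> 1%N ->
  ~ commute (expgz (gv (src d)) k) (gv (tgt d) ^ (dv d)^-1).
Proof.
move=> ndk nunit com.
pose l : seq (int * (E * bool)) := [:: (k, d); (1%R, rdart d); ((- k)%R, d); ((-1)%R, rdart d)].
have ll : is_path (src d) l (src d).
  by rewrite /l /= !src_rdart !tgt_rdart !eqxx.
have n1 (i : int) : `|i|%N = 1%N -> ~~ (lam (rdart d) %| i)%Z.
  by move=> i1; rewrite dvdzE i1 dvdn1; apply/eqP.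
have red_l : reduced_path L l.
  rewrite /reduced_path /l /= /no_pinch /= !negb_and !n1 ?orbT //.
  by rewrite dvdzE abszN -dvdzE ndk orbT.
apply: (reduced_path_neq1 maxT (k := 0%R) rootC Cp ll red_l) => //.
rewrite /l /= dart_val_rdart tgt_rdart !expg0 !expg1 !mulg1 expgzN.
set x := expgz _ _ in com *; set y := gv (tgt d) in com *; set t := dv d in com *.
transitivity (x * y ^ t^-1 * x^-1 * (y ^ t^-1)^-1).
  by rewrite conjgE invgK !invgM !invgK !mulgA.
by rewrite com mulgK mulgV.
Qed.

(** * Loops with a unit label at one end only *)

Section UnitLabel.
Context (d : E * bool).
Hypotheses (unit_d : `|lam (rdart d)|%N = 1%N) (lam_gt1 : (1 < `|lam d|)%N).

(** The images of [c] and [c ^ t] have the same order, while [(c ^ t)^(lam d)] is [c] or its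
    inverse. Hence this order is prime to [lam d], and [lam d] can be inverted in exponents. *)
Lemma loop_power (H : groupType) (f : {multiplicative G -> H}) : C H ->
  exists v : int, f (gv (src d)) = expgz (f (gv (src d))) (lam d * v) /\
    f (gv (src d) ^ dv d) = expgz (f (gv (src d))) (lam (rdart d) * v).
Proof.
move=> CH; set c := gv (src d); have loop := unit_is_loop unit_d.
have root : expgz (f (c ^ dv d)) (lam d) = expgz (f c) (lam (rdart d)).
  by rewrite -!gmulfz -expgzJ (rep_dart rep_G) loop.
have [n n_gt0 oc] := periodic_order (f c) (perC CH).
have oy : has_order (f (c ^ dv d)) n by rewrite multfJ; apply/has_orderJ.
(* With [g] the gcd, the exponent [n %/ g] already kills the image of [c], so [g = 1]. *)
have co : coprimez n (lam d).
  rewrite coprimezE /= /coprime; set g := gcdn _ _.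
  have g_gt0 : (0 < g)%N by rewrite gcdn_gt0 n_gt0.
  have : expgz (f c) (lam (rdart d) * (n %/ g)%N) = 1.
    rewrite expgzM -root -expgzM; apply/oy.
    rewrite dvdzE abszM /= muln_divA ?dvdn_gcdl // mulnC -muln_divA ?dvdn_gcdr //.
    exact: dvdn_mulr.
  move/oc; rewrite dvdzE abszM unit_d mul1n /= => dvd.
  have le_n : (n <= n %/ g)%N.
    by apply: dvdn_leq dvd; rewrite divn_gt0 // dvdn_leq ?dvdn_gcdl.
  rewrite eqn_leq g_gt0 andbT leqNgt; apply/negP => g_gt1.
  by have := ltn_Pdiv g_gt1 n_gt0; rewrite ltnNge le_n.
have /coprimezP[[u v] /= uv] := co.
have red_n (x : H) : has_order x n -> x = expgz x (lam d * v).
  move=> ox; rewrite -{1}[x]expgz1 -uv expgzD [(v * _)%R]mulrC.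
  have -> : expgz x (u * n) = 1 by apply/ox; apply: dvdz_mull.
  by rewrite mul1g.
exists v; split; first exact: red_n.
by rewrite {1}(red_n _ oy) expgzM root -expgzM.
Qed.

Lemma no_pinch_label (x y : int * (E * bool)) : ~~ (lam y.2 %| y.1)%Z -> no_pinch L x y.
Proof. by move=> nd; rewrite /no_pinch negb_and nd orbT. Qed.

Lemma no_pinch_edge (x y : int * (E * bool)) : y.2.1 != x.2.1 -> no_pinch L x y.
Proof. by apply: contraNN => /andP[/eqP-> _]. Qed.

Lemma reduced_word_contra v l : is_path v l v -> reduced_path L l -> l <> [::] ->
  path_val gv te v l 0 = 1 -> False.
Proof. by move=> ll red_l l0; apply: (reduced_path_neq1 maxT rootC Cp ll red_l l0). Qed.

(** Write [lam d2] as [lam d ^+ m * nu]. In each image [c^nu] is a power of [c^(lam d2)], hence of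
    the conjugate of [w], and [c^nu ^ t] is a power of [c^nu]. The resulting commutator is reduced
    in [G] since [lam d] does not divide [nu]. *)
Lemma unit_label_other_nonunit d2 : src d2 = src d -> d2.1 != d.1 ->
  `|lam (rdart d2)|%N <> 1%N -> False.
Proof.
move=> sd2 ne nunit; have loop := unit_is_loop unit_d.
have mu0 : lam d2 != 0%R by apply: label_neq0.
have [m [nu [def_mu ndnu]]] := coprime_prime_to_part lam_gt1 mu0.
set c := gv (src d); set t := dv d; set t2 := dv d2; set w := gv (tgt d2).
have root2 : expgz (w ^ t2^-1) (lam (rdart d2)) = expgz c (lam d2).
  by rewrite conj_root sd2.
have com : commute (expgz c nu ^ t) (w ^ t2^-1).
  apply: residually_commute => H f CH; rewrite expgzJ gmulfz.
  have [v [fc fy]] := loop_power f CH.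
  have fc_m k : f c = expgz (f c) ((lam d * v) ^+ k)%R.
    by elim: k => [|k IHk] //; rewrite exprSr expgzM -IHk.
  have fnu : expgz (f c) nu = expgz (f (w ^ t2^-1)) (lam (rdart d2) * v ^+ m).
    rewrite [RHS]expgzM -[X in expgz X (v ^+ m)]gmulfz root2 gmulfz -expgzM def_mu.
    by rewrite {1}(fc_m m) exprMn -expgzM mulrAC.
  rewrite -/c -/t fy -expgzM mulrC expgzM fnu -expgzM.
  by apply: commute_sym; apply: commute_expgz; apply: commute_refl.
pose l : seq (int * (E * bool)) := [:: (0%R, d2); (1%R, rdart d2); (0%R, rdart d); (nu, d);
  (0%R, d2); ((-1)%R, rdart d2); (0%R, rdart d); ((- nu)%R, d)].
have ll : is_path (src d) l (src d).
  by rewrite /l /= !src_rdart !tgt_rdart !sd2 loop !eqxx.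
have n1 (i : int) : `|i|%N = 1%N -> ~~ (lam (rdart d2) %| i)%Z.
  by move=> i1; rewrite dvdzE i1 dvdn1; apply/eqP.
have red_l : reduced_path L l.
  have ndnuN : ~~ (lam d %| (- nu)%R)%Z by rewrite dvdzE abszN -dvdzE.
  have ne' : d.1 != d2.1 by rewrite eq_sym.
  rewrite /reduced_path /l /= andbT; repeat (apply/andP; split);
  by [apply: no_pinch_edge | apply: no_pinch_label; rewrite /= ?n1].
apply: (reduced_word_contra ll red_l) => //.
rewrite /l /= !dart_val_rdart !tgt_rdart !sd2 loop !expg0 !expg1 !mulg1 !mul1g expgzN.
rewrite -/c -/t -/t2 -/w.
transitivity (w ^ t2^-1 * expgz c nu ^ t * (w ^ t2^-1)^-1 * (expgz c nu ^ t)^-1).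
  by rewrite !conjgE invgK !invgM !invgK !mulgA.
by rewrite -com mulgK mulgV.
Qed.

(** In each image [c ^ t] is a power of [c], and [t2^-1] maps [c] to a power of itself. So [c ^ t]
    commutes with its conjugate by [t2^-1], whereas in [G] their commutator is a reduced word. *)
Lemma unit_label_other_unit d2 : src d2 = src d -> d2.1 != d.1 ->
  `|lam (rdart d2)|%N = 1%N -> False.
Proof.
move=> sd2 ne unit2; have loop := unit_is_loop unit_d; have loop2 := unit_is_loop unit2.
set c := gv (src d); set t := dv d; set t2 := dv d2.
have sqr2 : (lam (rdart d2) * lam (rdart d2))%R = 1%R.
  by move: unit2; case: (lam _) => [[|[|//]] | [|//]].
have z2 : c ^ t2^-1 = expgz c (lam d2 * lam (rdart d2)).
  by have := conj_root d2; rewrite loop2 sd2 expgzM => <-; rewrite -expgzM sqr2.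
have com : commute (c ^ t) ((c ^ t) ^ t2^-1).
  apply: residually_commute => H f CH; rewrite [f (_ ^ t2^-1)]multfJ.
  have [v [fc fy]] := loop_power f CH.
  rewrite -/c -/t in fy; rewrite fy expgzJ -multfJ z2 gmulfz -expgzM.
  by rewrite /commute -!expgzD addrC.
pose l : seq (int * (E * bool)) := [:: (0%R, rdart d); (1%R, d); (0%R, d2); (0%R, rdart d);
  (1%R, d); (0%R, rdart d2); (0%R, rdart d); ((-1)%R, d); (0%R, d2); (0%R, rdart d);
  ((-1)%R, d); (0%R, rdart d2)].
have ll : is_path (src d) l (src d).
  by rewrite /l /= !src_rdart !tgt_rdart loop2 !sd2 loop !eqxx.
have n1 (i : int) : `|i|%N = 1%N -> ~~ (lam d %| i)%Z.
  by move=> i1; rewrite dvdzE i1 dvdn1; rewrite neq_ltn lam_gt1 orbT.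
have red_l : reduced_path L l.
  have ne' : d.1 != d2.1 by rewrite eq_sym.
  rewrite /reduced_path /l /= andbT; repeat (apply/andP; split);
  by [apply: no_pinch_edge | apply: no_pinch_label; rewrite /= ?n1].
apply: (reduced_word_contra ll red_l) => //.
rewrite /l /= !dart_val_rdart !tgt_rdart loop2 !sd2 loop !expg0 !expg1 !mulg1 !mul1g.
rewrite -/c -/t -/t2.
transitivity (c ^ t * (c ^ t) ^ t2^-1 * (c ^ t)^-1 * ((c ^ t) ^ t2^-1)^-1).
  by rewrite !conjgE invgK !invgM !invgK !mulgA.
by rewrite com mulgK mulgV.
Qed.

End UnitLabel.

Lemma label_order d q : prime q -> (q %| `|lam d|)%N ->
  exists (H : groupType) (f : {multiplicative G -> H}) (n : nat),
    [/\ C H, has_order (f (gv (src d))) n, (0 < n)%N & (q ^ logn q `|lam d| %| n)%N].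
Proof.
move=> q_pr dvd_q; apply: contrapT => none.
have lam0 : lam d != 0%R by apply: label_neq0.
have /dvdzP[m1 def_lam] : (Posz q %| lam d)%Z by rewrite dvdzE.
have m10 : m1 != 0%R by apply: contraNneq lam0 => m10; rewrite def_lam m10 mul0r.
have nd : ~~ (lam d %| m1)%Z.
  apply/negP; rewrite dvdzE def_lam abszM => /dvdn_leq; rewrite absz_gt0 m10 => /(_ isT).
  by rewrite -{2}[`|m1|%N]muln1 leq_pmul2l ?absz_gt0 // leqNgt prime_gt1.
(* With a unit label at the other end, the word of [not_commute_tree] has a pinch, so a second edge
   is used. *)
have [unit_d | nunit] := eqVneq `|lam (rdart d)|%N 1%N.
  have lam_gt1 : (1 < `|lam d|)%N.
    by apply: leq_trans (prime_gt1 q_pr) (dvdn_leq _ dvd_q); rewrite absz_gt0.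
  have [d2 [sd2 ne]] := other_edge unit_d.
  have [unit2 | /eqP nunit2] := eqVneq `|lam (rdart d2)|%N 1%N.
    exact: (unit_label_other_unit unit_d lam_gt1 sd2 ne unit2).
  exact: (unit_label_other_nonunit unit_d lam_gt1 sd2 ne nunit2).
apply: (not_commute_tree nd (elimN eqP nunit)).
apply: residually_commute => H f CH; rewrite gmulfz.
have [n n_gt0 oc] := periodic_order (f (gv (src d))) (perC CH).
have ndn : ~~ (q ^ logn q `|lam d| %| n)%N by apply/negP => dvdn; apply: none; exists H, f, n.
(* In each image the power [m1] of the generator is a power of its [lam d]-th power, hence of the
   conjugated generator at [tgt d]. *)
have [j dvdj] := dvd_prime_defect n_gt0 q_pr lam0 ndn def_lam.
have -> : expgz (f (gv (src d))) m1 = expgz (f (gv (src d))) (lam d * j).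
  rewrite -[m1 in LHS](subrK (lam d * j)%R) expgzD.
  by have /oc-> := dvdj; rewrite mul1g.
have fr : expgz (f (gv (tgt d) ^ (dv d)^-1)) (lam (rdart d)) = expgz (f (gv (src d))) (lam d).
  by rewrite -!gmulfz conj_root.
rewrite expgzM -fr -expgzM.
by apply: commute_sym; apply: commute_expgz; apply: commute_refl.
Qed.

End Necessity.

(** * Combining finitely many periodic quotients *)

Section FiniteProducts.
Context (G : groupType) (I : finType).

Lemma periodic_product (K : I -> groupType) :
  (forall i, periodic (K i)) -> periodic (cartesian_product K).
Proof.
move=> perK x.
have ex_n i : exists n, (0 < n)%N /\ x i ^+ n = 1.
  by have [n n0 xn] := perK i (x i); exists n.
have [n nE] := choice ex_n.
exists (\prod_i n i)%N; first by apply: prodn_gt0 => i; have [] := nE i.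
apply: functional_extensionality_dep => i.
have comp (y : cartesian_product K) m : (y ^+ m) i = y i ^+ m.
  by elim: m => [|m IHm] //; rewrite !expgS -IHm.
rewrite comp (bigD1 i) //= expgnA; have [_ ->] := nE i.
exact: expg1n.
Qed.

(** The product map combines all the homomorphisms, and [g] is a projection recovering one of them.
    Finiteness of [I] keeps the product periodic. *)
Lemma hom_product (P : I -> forall H : groupType, {multiplicative G -> H} -> Prop) :
  (forall i, exists (H : groupType) (f : {multiplicative G -> H}), periodic H /\ P i H f) ->
  exists (H : groupType) (f : {multiplicative G -> H}), periodic H /\
    forall i, exists (K : groupType) (g : {multiplicative H -> K})
      (h : {multiplicative G -> K}),
      P i K h /\ forall x, g (f x) = h x.
Proof.
move=> exP.
pose T : Type := {H : groupType & {multiplicative G -> H}}.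
have exT i : exists Hf : T, periodic (tag Hf) /\ P i (tag Hf) (tagged Hf).
  have [H [f Hf]] := exP i.
  by exists (existT (fun H : groupType => {multiplicative G -> H}) H f).
have [F FE] := choice exT.
pose K i := tag (F i).
have fM : {morph (fun x => (fun i => tagged (F i) x) : cartesian_product K) : x y / x * y}.
  by move=> x y; apply: functional_extensionality_dep => i; apply: gmulfM.
exists (cartesian_product K), (mult_of fM); split.
  by apply: periodic_product => i; have [] := FE i.
move=> i; have gM : {morph (fun x : cartesian_product K => x i) : x y / x * y} by [].
by exists (K i), (mult_of gM), (tagged (F i)); split=> //; have [] := FE i.
Qed.

End FiniteProducts.

(** * Consequences for the labels and for the modular homomorphism *)

Section NecessaryConditions.
Context (Gam : multigraph) (L : labeling Gam).
Context (VT : {set vertex Gam}) (ET : {set edge Gam}).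
Hypotheses (conG : connected_graph Gam) (maxT : maximal_subtree VT ET).
Context (C : group_class) (p : nat).
Hypotheses (rootC : root_class C) (Cp : class_primes C p).
Hypothesis perC : forall X : groupType, C X -> periodic X.
Local Notation V := (vertex Gam).
Local Notation E := (edge Gam).
Local Notation G := (gbs_group L ET).
Local Notation gv := (gv L ET).
Local Notation te := (te L ET).
Local Notation modular := (modular (L := L) (T := ET)).
Hypotheses (redL : reduced L) (not_sol : ~ is_solvable G) (resG : residually C G).

Lemma labels_rho e b : rho_number (class_primes C) (L e b).
Proof.
move=> q q_pr dvd_q.
have [H [f [n [CH on n_gt0 dvd_n]]]] :=
  label_order conG maxT rootC Cp perC redL not_sol resG (d := (e, b)) q_pr dvd_q.
split=> //; exists H, (f (gv (src (e, b)))), n; split=> //; first exact: has_order_element.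
apply: dvdn_trans dvd_n; rewrite -{1}[q]expn1 dvdn_exp2l // logn_gt0 mem_primes q_pr dvd_q.
by rewrite absz_gt0 label_neq0.
Qed.

Lemma common_quotient : exists (H : groupType) (f : {multiplicative G -> H}),
  periodic H /\ forall d n, has_order (f (gv (src d))) n -> (0 < n)%N -> (`|lam L d| %| n)%N.
Proof.
(* A bound above all labels, so that the pairs of a dart and a prime divisor of its label fit in a
   finite index type. *)
pose B := (\max_(d : E * bool) `|lam L d|).+1.
pose P (i : (E * bool) * 'I_B) (H : groupType) (f : {multiplicative G -> H}) :=
  prime i.2 -> (i.2 %| `|lam L i.1|)%N ->
  exists n, has_order (f (gv (src i.1))) n /\ (i.2 ^ logn i.2 `|lam L i.1| %| n)%N.
have [|H [f [perH fP]]] := @hom_product G _ P.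
  case=> d q; case: (boolP (prime q && (q %| `|lam L d|)%N)) => [/andP[q_pr dvd_q] | nq].
    have [H [f [n [CH on _ dvd_n]]]] :=
      label_order conG maxT rootC Cp perC redL not_sol resG q_pr dvd_q.
    by exists H, f; split; [apply: perC | move=> _ _; exists n].
  (* Other pairs impose no condition; the trivial homomorphism serves for them. *)
  have [X CX _] : exists2 X : groupType, C X & exists x : X, x <> 1 by case: rootC.
  have oneM : {morph (fun _ : G => 1 : X) : x y / x * y} by move=> x y; rewrite mulg1.
  exists X, (mult_of oneM); split; first exact: perC.
  by move=> q_pr dvd_q; rewrite q_pr dvd_q in nq.
exists H, f; split=> // d n on n_gt0.
have lam_gt0 : (0 < `|lam L d|)%N by rewrite absz_gt0 label_neq0.
apply/dvdn_partP => // q; rewrite mem_primes => /and3P[q_pr _ dvd_q].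
have ltqB : (q < B)%N.
  by rewrite ltnS; apply: leq_trans (dvdn_leq lam_gt0 dvd_q) (leq_bigmax _).
have [K [g [h [Ph gf]]]] := fP (d, Ordinal ltqB).
have [m [om dvd_m]] := Ph q_pr dvd_q.
rewrite p_part; apply: dvdn_trans dvd_m _.
have : expgz (h (gv (src d))) n = 1.
  rewrite -gf -gmulfz; have -> : expgz (f (gv (src d))) n = 1 by apply/on.
  exact: multf1.
by move/om; rewrite dvdzE.
Qed.

(** The two sides of an edge relation have conjugate images of equal order, the order [o] at each
    end divided by the label. This makes [o v] inversely proportional to the absolute value of
    [r v], so every dilation has absolute value 1. *)
Lemma modular_edge e : modular (te e) = 1%R \/ modular (te e) = (-1)%R.
Proof.
have [H [f [perH fP]]] := common_quotient.
have ex_o v : exists n, (0 < n)%N /\ has_order (f (gv v)) n.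
  by have [n n0 on] := periodic_order (f (gv v)) perH; exists n.
have [o oE] := choice ex_o.
have edge_o e' : (o (edge_end e' true) * `|L e' false| =
                  o (edge_end e' false) * `|L e' true|)%N.
  have rel := congr1 f (gbs_is_rep L ET e'); rewrite multfJ !gmulfz in rel.
  have [o1_gt0 o1] := oE (edge_end e' true); have [o2_gt0 o2] := oE (edge_end e' false).
  have /dvdnP[a1 a1E] := fP (e', true) _ o1 o1_gt0.
  have /dvdnP[a2 a2E] := fP (e', false) _ o2 o2_gt0.
  have L1 : (0 < `|L e' true|)%N by rewrite absz_gt0 label_neq0.
  have L2 : (0 < `|L e' false|)%N by rewrite absz_gt0 label_neq0.
  rewrite /lam /src /= in a1E a2E.
  (* [a1] and [a2] are the orders of the two conjugate powers, so they have the same multiples. *)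
  have same (k : nat) : (a1 %| k)%N = (a2 %| k)%N.
    rewrite -(dvdn_pmul2r L1) -a1E -[RHS](dvdn_pmul2r L2) -a2E.
    have p1 : expgz (expgz (f (gv (edge_end e' true))) (L e' true)) k = 1 <->
              expgz (expgz (f (gv (edge_end e' false))) (L e' false)) k = 1.
      by rewrite -rel -expgzJ; split=> [->|/eqP]; rewrite ?conj1g ?conjg_eq1 // => /eqP.
    move: p1; rewrite -!expgzM o1 o2 !dvdzE !abszM /= ![(`|L _ _| * k)%N]mulnC.
    by move=> [h1 h2]; apply/idP/idP.
  have a12 : a1 = a2 by apply/eqP; rewrite eqn_dvd same dvdnn -same dvdnn.
  by rewrite a1E a2E a12 mulnAC.
have [] // := @potential_exists _ L VT ET maxT (fun=> True); move=> r r_pot _.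
have o0 v : ((o v)%:R != 0 :> rat)%R by rewrite pnatr_eq0 -lt0n; have [] := oE v.
have edge_oQ e' : ((o (edge_end e' true))%:R * `|labelQ L e' false| =
                   (o (edge_end e' false))%:R * `|labelQ L e' true|)%R.
  by rewrite /labelQ -!intr_norm -!abszE -!natrM edge_o.
(* Constant along each tree edge by [edge_oQ] and the potential relation, hence everywhere. *)
have scale v w : (`|r v| * (o v)%:R = `|r w| * (o w)%:R)%R.
  have /connectP[q] := maximal_subtree_spanning conG maxT v w.
  elim: q v => [|u q IHq] v /= => [_ -> // | /andP[/adjacentP[d [dT <- <-]] qq lq]].
  rewrite -(IHq _ qq lq).
  suff edge_scale e' : e' \in ET -> (`|r (edge_end e' true)| * (o (edge_end e' true))%:R =
      `|r (edge_end e' false)| * (o (edge_end e' false))%:R)%R.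
    by case: d dT {qq lq} => e' [] /= /edge_scale; rewrite /src /tgt /= => ->.
  case: r_pot => r0 rT /rT/(congr1 Num.norm); rewrite !normrM => rr.
  have l0 := labelQ_neq0 L e' false; rewrite -normr_eq0 in l0.
  apply: (mulIf l0); rewrite -mulrA edge_oQ mulrCA [(`|r _| * `|labelQ _ _ _|)%R]mulrC rr.
  by rewrite [(`|labelQ _ _ _| * _)%R]mulrC mulrCA mulrA.
have [f' [fv fs]] := affine_hom r_pot.
rewrite (modularE conG maxT (proj1 r_pot) fv) fs /= /dilation invf_div.
set x := (_ / _)%R; have : (`|x| == 1)%R; last first.
  by rewrite eqr_norml ler01 andbT => /orP[] /eqP; [left | right].
have nz : (`|labelQ L e true * r (edge_end e true)| != 0)%R.
  by rewrite normr_eq0 mulf_neq0 ?labelQ_neq0 //; apply: (proj1 r_pot).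
rewrite /x normf_div; apply/eqP/(mulIf nz); rewrite divfK // mul1r !normrM.
apply: (mulIf (o0 (edge_end e false))).
rewrite -mulrA (scale _ (edge_end e true)) mulrCA [(`|labelQ _ _ _| * _)%R]mulrC edge_oQ.
by rewrite [RHS]mulrAC [LHS]mulrC; congr (_ * _)%R; rewrite mulrC.
Qed.

(** Some [b], a non-trivial power of a vertex generator, is inverted by [g]. If all orders in the
    class are odd, the image of [g] is a power of its square, which centralizes the image of [b];
    that image then has order dividing 2, so it is trivial. *)
Lemma two_in_primes g : modular g = (-1)%R -> class_primes C 2.
Proof.
move=> mod_g; apply: contrapT => no2.
have odd_order (X : groupType) (x : X) n : C X -> has_order x n -> (0 < n)%N -> odd n.
  move=> CX ox n_gt0; apply: contrapT => /negP even_n; apply: no2.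
  split=> //; exists X, x, n; split=> //; first exact: has_order_element.
  by rewrite dvdn2.
have [] // := @potential_exists _ L VT ET maxT (fun=> True); move=> r r_pot _.
have [f [fv _]] := affine_hom r_pot; have r0 := proj1 r_pot.
have [[v _] _] := conG.
have [m [n [m0 n0 eq_g]]] := commensurable conG maxT g v.
have def_n : n = (- m)%R.
  have := congr1 f eq_g; rewrite multfJ !gmulfz fv !transl_z translJ => /transl_inj.
  have := modularE conG maxT r0 fv g; rewrite mod_g => <-.
  rewrite mulrN1 -mulrNz => /(congr1 (fun x => x / r v)%R).
  rewrite -[X in (X / _)%R]mulrzl mulfK // -[X in (X / _)%R]mulrzl mulfK // => /eqP.
  by rewrite eqr_int => /eqP.
set b := expgz (gv v) m in eq_g; rewrite def_n expgzN -/b in eq_g.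
suff b1 : b = 1 by move/eqP: (gv_order maxT b1); apply/negP.
apply: (residually_eq resG) => H h CH; rewrite multf1.
have [k k_gt0 og] := periodic_order (h g) (perC CH).
have [l l_gt0 ob] := periodic_order (h b) (perC CH).
have odd_k := odd_order _ _ _ CH og k_gt0; have odd_l := odd_order _ _ _ CH ob l_gt0.
have com2 : h b ^ (h g ^+ 2) = h b.
  by rewrite expgSr expg1 conjgM -!multfJ eq_g conjVg eq_g invgK.
have com i : h b ^ (h g ^+ (2 * i)) = h b.
  by rewrite expgnA; elim: i => [|i IHi]; rewrite ?conjg1 // expgSr conjgM IHi com2.
(* As [k] is odd, the exponent is [k + 1]. *)
have hgk : h g = h g ^+ (2 * (k.+1)./2).
  rewrite mul2n halfK /= odd_k subn0 expgSr.
  have /og : (Posz k %| Posz k)%Z by apply: dvdzz.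
  by rewrite /= => ->; rewrite mul1g.
have : h b ^ h g = h b by rewrite hgk com.
rewrite -multfJ eq_g multfV => hb.
have : expgz (h b) 2 = 1 by rewrite /= expgSr expg1 -{1}hb mulVg.
move/ob; rewrite dvdzE /= => dvd2.
have /ob : (Posz l %| 1%R)%Z.
  have := dvdn_leq _ dvd2; case: (l) odd_l dvd2 => [|[|[|]]] // ? _ _ /(_ isT).
  by [].

Qed.

End NecessaryConditions.

(** The dilation part is multiplicative; it is 1 on vertex generators and a sign on stable
    letters. *)
Lemma modular_range (Gam : multigraph) (L : labeling Gam) (VT : {set vertex Gam})
    (ET : {set edge Gam}) :
  connected_graph Gam -> maximal_subtree VT ET ->
  (forall e, modular (te L ET e) = 1%R \/ modular (te L ET e) = (-1)%R) ->
  range (modular (L := L) (T := ET)) `<=` [set 1%R; (-1)%R].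
Proof.
move=> conG maxT mod_e.
have [] // := @potential_exists _ L VT ET maxT (fun=> True); move=> r r_pot _.
have [f [fv fs]] := affine_hom r_pot.
have modE := modularE conG maxT (proj1 r_pot) fv.
pose sgn (g : gbs_group L ET) := val (f g).2 = 1%R \/ val (f g).2 = (-1)%R.
suff all_sgn : forall g, sgn g.
  move=> _ [g _ <-]; rewrite modE.
  by case: (all_sgn g) => ->; rewrite ?invrN invr1; [left | right].
have sgnV g : sgn g -> sgn g^-1.
  by rewrite /sgn multfV sdV /= => -[] ->; rewrite ?invrN invr1; auto.
have sgn_te e : sgn (te L ET e).
  by case: (mod_e e); rewrite modE => /(congr1 GRing.inv);
    rewrite invrK ?invrN invr1; [left | right].
apply: presented_ind => [|g h sg sh|[v|e]|[v|e]].
- by left; rewrite multf1.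
- rewrite /sgn gmulfM -[val _]/(val (f g).2 * val (f h).2)%R.
  by case: sg => ->; case: sh => ->; rewrite ?mulN1r ?mul1r ?opprK; auto.
- by left; rewrite -[pres_gen _ _]/(gv L ET v) fv.
- by rewrite -te_stable.
- by apply: sgnV; left; rewrite -[pres_gen _ _]/(gv L ET v) fv.
- by apply: sgnV; rewrite -te_stable.
Qed.

Theorem theorem3 (Gam : multigraph) (L : labeling Gam)
    (VT : {set vertex Gam}) (ET : {set edge Gam}) (C : group_class) :
  connected_graph Gam ->
  maximal_subtree VT ET ->
  root_class C ->
  (forall X : groupType, C X -> periodic X) ->
  ~ is_solvable (gbs_group L ET) ->
  reduced L ->
  let G := gbs_group L ET in
  let Delta : G -> rat := modular (L := L) (T := ET) in
  let rho := class_primes C in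
  [/\ range Delta = [set 1%R] ->
        (residually C G <-> (forall e b, rho_number rho (L e b))),
      range Delta = [set 1%R; (-1)%R] ->
        (residually C G <-> (forall e b, rho_number rho (L e b)) /\ rho 2)
    & ~ (range Delta `<=` [set 1%R; (-1)%R]) -> ~ residually C G].
Proof.
move=> conG maxT rootC perC not_sol redL G Delta rho.
have [p Cp] := class_exists_prime rootC perC.
have in_range g : range Delta (Delta g) by exists g.
split=> [range1 | range2 | nrange resG].
- split=> [resG e b | rhoL].
    exact: (labels_rho conG maxT rootC Cp perC redL not_sol resG).
  apply: (residually_positive conG maxT rootC Cp rhoL) => e.
  by have := in_range (te L ET e); rewrite range1.
- split=> [resG | [rhoL rho2]].
    split=> [e b | ]; first exact: (labels_rho conG maxT rootC Cp perC redL not_sol resG).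
    have [g _ mod_g] : range Delta (-1)%R by rewrite range2; right.
    exact: (two_in_primes conG maxT perC resG mod_g).
  apply: (residually_signed conG maxT rootC Cp rhoL rho2) => e.
  by have := in_range (te L ET e); rewrite range2.
apply: nrange; apply: (modular_range conG maxT) => e.
exact: (modular_edge conG maxT rootC Cp perC redL not_sol resG).
Qed.
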